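(* Let $F$ be a field of characteristic zero and let $M_{1,2}(F)$ be the $*$-superalgebra described in the context. For a composition $(n_1,n_2,n_3,n_4)$ of $3$ let $W_{(n_1,n_2,n_3,n_4)}$ be the space of $*$-polynomials in $y_1^\pm,y_2^\pm,y_3^\pm,z_1^\pm,z_2^\pm,z_3^\pm$ that are multihomogeneous of total degree $n_1$ in $y_1^+,y_2^+,y_3^+$, $n_2$ in $y_1^-,y_2^-,y_3^-$, $n_3$ in $z_1^+,z_2^+,z_3^+$ and $n_4$ in $z_1^-,z_2^-,z_3^-$. Then the following decompositions into irreducible modules hold, where in each case the listed polynomials are highest weight vectors generating the indicated copies: (1) $Id_2^*\cap W_{(3,0,0,0)}\cong 2W^{((2,1),\emptyset,\emptyset,\emptyset)}\oplus W^{((1^3),\emptyset,\emptyset,\emptyset)}$, with $[y_1^+,y_2^+]y_1^+$, $[(y_1^+)^2,y_2^+]$ and $St_3(y_1^+,y_2^+,y_3^+)$; (2) $Id_2^*\cap W_{(0,3,0,0)}\cong W^{(\emptyset,(2,1),\emptyset,\emptyset)}$, with $[(y_1^-)^2,y_2^-]$; (3) $Id_2^*\cap W_{(2,1,0,0)}\cong 2W^{((2),(1),\emptyset,\emptyset)}\oplus 3W^{((1^2),(1),\emptyset,\emptyset)}$, with $[(y_1^+)^2,y_1^-]$, $[y_1^+,y_1^-y_1^+]$ and $[y_1^+,y_2^+]y_1^-$, $y_1^+y_1^-y_2^+-y_2^+y_1^-y_1^+$, $y_1^-[y_1^+,y_2^+]$; (4) $Id_2^*\cap W_{(1,2,0,0)}\cong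 2W^{((1),(2),\emptyset,\emptyset)}\oplus 2W^{((1),(1^2),\emptyset,\emptyset)}$, with $[y_1^+,(y_1^-)^2]$, $y_1^-[y_1^+,y_1^-]$ and $[y_1^+,y_1^-y_2^--y_2^-y_1^-]$, $y_1^-[y_1^+,y_2^-]-y_2^-[y_1^+,y_1^-]$; (5) $Id_2^*\cap W_{(2,0,1,0)}\cong 2W^{((1^2),\emptyset,(1),\emptyset)}$, with $[y_1^+,y_2^+]z_1^+$, $z_1^+[y_1^+,y_2^+]$; (6) $Id_2^*\cap W_{(2,0,0,1)}\cong 2W^{((1^2),\emptyset,\emptyset,(1))}$, with $[y_1^+,y_2^+]z_1^-$, $z_1^-[y_1^+,y_2^+]$; (7) $Id_2^*\cap W_{(1,1,1,0)}\cong 2W^{((1),(1),(1),\emptyset)}$, with $[y_1^+,y_1^-]z_1^+$, $z_1^+[y_1^+,y_1^-]$; (8) $Id_2^*\cap W_{(1,1,0,1)}\cong 2W^{((1),(1),\emptyset,(1))}$, with $[y_1^+,y_1^-]z_1^-$, $z_1^-[y_1^+,y_1^-]$; (9) $Id_2^*\cap W_{(1,0,2,0)}\cong W^{((1),\emptyset,(2),\emptyset)}\oplus W^{((1),\emptyset,(1^2),\emptyset)}$, with $[y_1^+,(z_1^+)^2]$ and $[y_1^+,z_1^+z_2^+-z_2^+z_1^+]$; (10) $Id_2^*\cap W_{(1,0,0,2)}\cong W^{((1),\emptyset,\emptyset,(2))}\oplus W^{((1),\emptyset,\emptyset,(1^2))}$, with $[y_1^+,(z_1^-)^2]$ and $[y_1^+,z_1^-z_2^--z_2^-z_1^-]$;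 (11) $Id_2^*\cap W_{(1,0,1,1)}\cong 2W^{((1),\emptyset,(1),(1))}$, with $[y_1^+,z_1^+z_1^-]$, $[y_1^+,z_1^-z_1^+]$; (12) $Id_2^*\cap W_{(0,0,3,0)}\cong W^{(\emptyset,\emptyset,(3),\emptyset)}\oplus W^{(\emptyset,\emptyset,(1^3),\emptyset)}$, with $(z_1^+)^3$ and $St_3(z_1^+,z_2^+,z_3^+)$; (13) $Id_2^*\cap W_{(0,0,0,3)}\cong W^{(\emptyset,\emptyset,\emptyset,(3))}\oplus W^{(\emptyset,\emptyset,\emptyset,(1^3))}$, with $(z_1^-)^3$ and $St_3(z_1^-,z_2^-,z_3^-)$; (14) $Id_2^*\cap W_{(0,2,1,0)}\cong W^{(\emptyset,(2),(1),\emptyset)}\oplus W^{(\emptyset,(1^2),(1),\emptyset)}$, with $y_1^-z_1^+y_1^-$ and $y_1^-z_1^+y_2^--y_2^-z_1^+y_1^-$; (15) $Id_2^*\cap W_{(0,2,0,1)}\cong W^{(\emptyset,(2),\emptyset,(1))}\oplus W^{(\emptyset,(1^2),\emptyset,(1))}$, with $y_1^-z_1^-y_1^-$ and $y_1^-z_1^-y_2^--y_2^-z_1^-y_1^-$; (16) $Id_2^*\cap W_{(0,1,2,0)}\cong 2W^{(\emptyset,(1),(1^2),\emptyset)}$, with $z_1^+y_1^-z_2^+-z_2^+y_1^-z_1^+$, $[y_1^-,z_1^+z_2^+-z_2^+z_1^+]$; (17) $Id_2^*\cap W_{(0,1,0,2)}\cong 2W^{(\emptyset,(1),\emptyset,(1^2))}$,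 with $z_1^-y_1^-z_2^--z_2^-y_1^-z_1^-$, $[y_1^-,z_1^-z_2^--z_2^-z_1^-]$; (18) $Id_2^*\cap W_{(0,0,2,1)}\cong W^{(\emptyset,\emptyset,(2),(1))}\oplus W^{(\emptyset,\emptyset,(1^2),(1))}$, with $(z_1^+)^2z_1^--z_1^+z_1^-z_1^++z_1^-(z_1^+)^2$ and $[z_1^+,z_2^+]z_1^-+(z_1^+z_1^-z_2^+-z_2^+z_1^-z_1^+)+z_1^-[z_1^+,z_2^+]$; (19) $Id_2^*\cap W_{(0,0,1,2)}\cong W^{(\emptyset,\emptyset,(1),(2))}\oplus W^{(\emptyset,\emptyset,(1),(1^2))}$, with $(z_1^-)^2z_1^+-z_1^-z_1^+z_1^-+z_1^+(z_1^-)^2$ and $[z_1^-,z_2^-]z_1^++(z_1^-z_1^+z_2^--z_2^-z_1^+z_1^-)+z_1^+[z_1^-,z_2^-]$; (20) $Id_2^*\cap W_{(0,1,1,1)}\cong 2W^{(\emptyset,(1),(1),(1))}$, with $z_1^+y_1^-z_1^-+z_1^-y_1^-z_1^+$ and $[y_1^-,z_1^+z_1^-+z_1^-z_1^+]$. Here $Id_2^*$ stands for $Id_2^*(M_{1,2}(F))$.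
   Context: $F$ is a field of characteristic zero. $M_{1,2}(F)$ is the algebra of $3\times 3$ matrices over $F$ with $\mathbb{Z}_2$-grading whose even part is spanned by $e_{11},e_{22},e_{23},e_{32},e_{33}$ and odd part by $e_{12},e_{13},e_{21},e_{31}$ ($e_{ij}$ matrix units), with the orthosymplectic superinvolution $*$ sending the matrix with rows $(a,b,c),(d,e,f),(g,h,i)$ to the matrix with rows $(a,-g,d),(c,i,-f),(-b,-h,e)$. Thus the even symmetric, even skew, odd symmetric, odd skew parts are $\mathrm{span}\{e_{11},e_{22}+e_{33}\}$, $\mathrm{span}\{e_{22}-e_{33},e_{23},e_{32}\}$, $\mathrm{span}\{e_{12}-e_{31},e_{13}+e_{21}\}$, $\mathrm{span}\{e_{12}+e_{31},e_{13}-e_{21}\}$. The free $*$-superalgebra is the free associative algebra on variables $y_i^+$ (even symmetric), $y_i^-$ (even skew), $z_i^+$ (odd symmetric), $z_i^-$ (odd skew), $i\ge1$; a $*$-polynomial is a $*$-identity of $M_{1,2}(F)$ if it vanishes under every substitution of each variable by an element of the corresponding part of $M_{1,2}(F)$, and $Id_2^*(M_{1,2}(F))$ is the set of all $*$-identities. $[a,b]=ab-ba$ and $St_3(x_1,x_2,x_3)=\sum_{\theta\in S_3}\mathrm{sgn}(\theta)x_{\theta(1)}x_{\theta(2)}x_{\theta(3)}$. The space $Id_2^*(M_{1,2}(F))\cap W_{(n_1,n_2,n_3,n_4)}$ is a module for the product of four general linear groups acting by linear substitutions on the spans of the variables of each of the four types; for a multipartition $\langle\lambda\rangle=(\lambda(1),\lambda(2),\lambda(3),\lambda(4))$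 with $\lambda(i)\vdash n_i$ (partitions written with $\emptyset$ for the empty partition and $(1^k)$ for $(1,\dots,1)$), $W^{\langle\lambda\rangle}$ denotes the irreducible polynomial module of highest weight $\langle\lambda\rangle$, and $kW^{\langle\lambda\rangle}$ a direct sum of $k$ copies. *)

(* Defs.v *)
From HB Require Import structures.
From mathcomp Require Import all_boot all_order all_algebra.
Set Implicit Arguments. Unset Strict Implicit. Unset Printing Implicit Defensive.
Import Order.TTheory GRing.Theory Num.Theory.
Local Open Scope ring_scope.

(* Letters (free generators).  A letter is a pair (t, i) with               *)
(*   t = 0 : y^+ (even symmetric),  t = 1 : y^- (even skew),                 *)
(*   t = 2 : z^+ (odd symmetric),   t = 3 : z^- (odd skew),                  *)
(* and i : 'I_3 the index (paper index i+1).  In degree 3 only the first     *)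
(* three variables of each type can occur, so GL_3 of each type acts.        *)
Definition letter := ('I_4 * 'I_3)%type.

Inductive ncexpr : Type :=
| EVar of letter
| EAdd of ncexpr & ncexpr
| EOpp of ncexpr
| EMul of ncexpr & ncexpr.

Declare Scope nc_scope.
Delimit Scope nc_scope with nc.
Bind Scope nc_scope with ncexpr.
Notation "a + b" := (EAdd a b) : nc_scope.
Notation "- a" := (EOpp a) : nc_scope.
Notation "a - b" := (EAdd a (EOpp b)) : nc_scope.
Notation "a * b" := (EMul a b) : nc_scope.

Definition comm (a b : ncexpr) : ncexpr := (a * b - b * a)%nc.
Definition St3 (a b c : ncexpr) : ncexpr :=
  (a * b * c - a * c * b - b * a * c + b * c * a + c * a * b - c * b * a)%nc.

(* variables with the paper's indices k = 1, 2, 3 *)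
Definition yp (k : nat) : ncexpr := EVar (inord 0, inord k.-1).
Definition ym (k : nat) : ncexpr := EVar (inord 1, inord k.-1).
Definition zp (k : nat) : ncexpr := EVar (inord 2, inord k.-1).
Definition zm (k : nat) : ncexpr := EVar (inord 3, inord k.-1).

Fixpoint coef (F : pzRingType) (e : ncexpr) (w : seq letter) : F :=
  match e with
  | EVar a => (w == [:: a])%:R
  | EAdd p q => coef F p w + coef F q w
  | EOpp p => - coef F p w
  | EMul p q => \sum_(i < (size w).+1) coef F p (take i w) * coef F q (drop i w)
  end.

(* The space of homogeneous degree-3 *-polynomials (coefficient functions on
   words of length 3).  All W_(n1,n2,n3,n4) with n1+n2+n3+n4 = 3 live here. *)
Notation Poly F := {ffun 3.-tuple letter -> (F : fieldType)^o}.

(* the degree-3 polynomial given by an expression (all expressions used are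
   homogeneous of degree 3) *)
Definition poly_of (F : fieldType) (e : ncexpr) : Poly F :=
  [ffun w : 3.-tuple letter => coef F e w].

Section M12.
Variable F : fieldType.

(* even part: span of e11, e22, e23, e32, e33 (block diagonal 1+2) *)
Definition evenM (A : 'M[F]_3) : Prop :=
  forall i j : 'I_3, ((i == 0 :> nat) != (j == 0 :> nat)) -> A i j = 0.
(* odd part: span of e12, e13, e21, e31 *)
Definition oddM (A : 'M[F]_3) : Prop :=
  forall i j : 'I_3, ((i == 0 :> nat) == (j == 0 :> nat)) -> A i j = 0.

(* orthosymplectic superinvolution:
   rows (a,b,c),(d,e,f),(g,h,i)  |->  rows (a,-g,d),(c,i,-f),(-b,-h,e) *)
Definition star (A : 'M[F]_3) : 'M[F]_3 :=
  \matrix_(i < 3, j < 3)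
    (let e := fun a b : nat => A (inord a) (inord b) in
     match nat_of_ord i, nat_of_ord j with
     | 0, 0 => e 0 0 | 0, 1 => - e 2 0 | 0, _ => e 1 0
     | 1, 0 => e 0 2 | 1, 1 => e 2 2 | 1, _ => - e 1 2
     | _, 0 => - e 0 1 | _, 1 => - e 2 1 | _, _ => e 1 1
     end).

Definition partM (t : 'I_4) (A : 'M[F]_3) : Prop :=
  (if (t < 2)%N then evenM A else oddM A) /\
  star A = (if odd t then - A else A).

Definition evalP (s : letter -> 'M[F]_3) (p : Poly F) : 'M[F]_3 :=
  \sum_(w : 3.-tuple letter) p w *: \prod_(k < 3) s (tnth w k).

Definition isId (p : Poly F) : Prop :=
  forall s : letter -> 'M[F]_3, (forall a : letter, partM a.1 (s a)) ->
    evalP s p = 0.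

Definition inW (n : seq nat) (p : Poly F) : Prop :=
  forall w : 3.-tuple letter, p w != 0 ->
    forall t : 'I_4, count (fun a : letter => a.1 == t) w = nth 0%N n t.

(* Action of GL_3 x GL_3 x GL_3 x GL_3 by linear substitutions: g t acts on  *)
(* the variables of type t by x_(t,i) |-> sum_j (g t) j i x_(t,j).           *)
Definition isGL (g : 'I_4 -> 'M[F]_3) : Prop := forall t, g t \in unitmx.

Definition subst_coef (g : 'I_4 -> 'M[F]_3) (v u : letter) : F :=
  if v.1 == u.1 then g v.1 v.2 u.2 else 0.

Definition act (g : 'I_4 -> 'M[F]_3) (p : Poly F) : Poly F :=
  [ffun w : 3.-tuple letter =>
     \sum_(u : 3.-tuple letter)
        p u * \prod_(k < 3) subst_coef g (tnth w k) (tnth u k)].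

Definition submodule (S : Poly F -> Prop) : Prop :=
  [/\ S 0,
      forall p q, S p -> S q -> S (p + q),
      forall (c : F) p, S p -> S (c *: p)
    & forall g p, isGL g -> S p -> S (act g p)].

Definition gen (f : Poly F) (p : Poly F) : Prop :=
  forall S, submodule S -> S f -> S p.

Definition irreducible_gen (f : Poly F) : Prop :=
  forall S, submodule S -> (forall p, S p -> gen f p) ->
    (forall p, S p -> p = 0) \/ (forall p, gen f p -> S p).

Definition upper_unitri (A : 'M[F]_3) : Prop :=
  (forall i : 'I_3, A i i = 1) /\ (forall i j : 'I_3, (j < i)%N -> A i j = 0).

Definition hwv (lam : seq (seq nat)) (p : Poly F) : Prop :=
  [/\ p != 0,
      forall d : 'I_4 -> 'I_3 -> F, (forall t i, d t i != 0) ->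
        act (fun t => diag_mx (\row_i d t i)) p =
        (\prod_(t < 4) \prod_(i < 3) d t i ^+ nth 0%N (nth [::] lam t) i) *: p
    & forall g, (forall t, upper_unitri (g t)) -> act g p = p].

(* Id_2^*(M_{1,2}(F)) cap W_n is the direct sum of the submodules generated
   by the listed highest weight vectors (each irreducible, isomorphic to
   W^lam since it is irreducible with a highest weight vector of weight lam) *)
Definition decomp (n : seq nat) (L : seq (ncexpr * seq (seq nat))) : Prop :=
  let f k := poly_of F (nth (EVar (0, 0), [::]) L k).1 in
  let lam k := (nth (EVar (0, 0), [::]) L k).2 in
  [/\ forall k, (k < size L)%N ->
        [/\ isId (f k), inW n (f k), hwv (lam k) (f k), irreducible_gen (f k)
          & forall p, gen (f k) p -> isId p /\ inW n p],
      forall p, isId p -> inW n p ->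
        exists ps : nat -> Poly F,
          (forall k, (k < size L)%N -> gen (f k) (ps k)) /\
          p = \sum_(k < size L) ps k
    & forall ps : nat -> Poly F,
        (forall k, (k < size L)%N -> gen (f k) (ps k)) ->
        \sum_(k < size L) ps k = 0 ->
        forall k, (k < size L)%N -> ps k = 0].

End M12.

(* Main.v *)
Require Import Defs.
From HB Require Import structures.
From Stdlib Require Import Classical_Prop.
From mathcomp Require Import all_boot all_order all_algebra fingroup perm.
From mathcomp Require Import ring.
Set Implicit Arguments. Unset Strict Implicit. Unset Printing Implicit Defensive.
Import Order.TTheory GRing.Theory Num.Theory.
Local Open Scope ring_scope.

(* A degree-3 polynomial p and a word u of three letters give a vector
   c(s) = p(u.s) of F[S_3], and conversely c and a word v give the polynomial
   sum_s c(s) v.s.  Polarization (GL is dense in matrices and F is infinite)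
   shows that a GL-submodule containing p contains sum_s p(u.s) v.s for every v
   with the same letter types as u.  In characteristic 0 a submodule of W_n is
   therefore determined by the vectors c read off along the words with types in
   a fixed order, and it is an identity iff all these c lie in the kernel of the
   functionals c |-> sum_s c(s) (A_s(1) A_s(2) A_s(3))_ij, where each A_k runs
   over a basis of the relevant part of M_{1,2}.  Each case then amounts to
   integer linear algebra in dimension 6: the vectors coming from the highest
   weight vectors form a basis of this kernel, and the span of those coming from
   a single one is irreducible under the permutations preserving the types. *)

(** * Rearrangements of three letters *)

(** Substitutions change letters while S_3 moves places, and the two actions commute. This is why
    properties of vectors of F[S_3], read off along single words, pass to every polynomial of a
    generated submodule. No rank or kernel is computed: each case supplies vectors b_i, dual
    vectors, chosen functionals theta_j and vectors e_j with 12 id = sum b_i dual_i^T + sum e_j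
    theta_j^T. Applied to a vector killed by all theta_j, this identity writes it through the b_i,
    so the listed modules exhaust the identities; orthogonality of the duals of one module to the
    vectors of the others makes the sum direct. Only equalities of integers are checked, and they
    hold in every field of characteristic 0, where 12 is invertible. *)

Lemma inordE n k (lt_kn : (k < n.+1)%N) : inord k = Ordinal lt_kn.
Proof. by apply: val_inj; rewrite /= inordK. Qed.

Definition inord_smallE := (@inordE 2 0 isT, @inordE 2 1 isT, @inordE 2 2 isT,
  @inordE 3 0 isT, @inordE 3 1 isT, @inordE 3 2 isT, @inordE 3 3 isT).

Local Notation o0 := (@Ordinal 3 0 isT).
Local Notation o1 := (@Ordinal 3 1 isT).
Local Notation o2 := (@Ordinal 3 2 isT).

(** Explicit lists, because [enum] does not reduce in the computed checks. *)
Definition I3 : seq 'I_3 := [:: o0; o1; o2].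
Definition I4 : seq 'I_4 :=
  [:: @Ordinal 4 0 isT; @Ordinal 4 1 isT; @Ordinal 4 2 isT; @Ordinal 4 3 isT].

Lemma enumI3 : enum 'I_3 = I3.
Proof. by apply: (inj_map val_inj); rewrite val_enum_ord. Qed.

Lemma enumI4 : enum 'I_4 = I4.
Proof. by apply: (inj_map val_inj); rewrite val_enum_ord. Qed.

Lemma mem_I3 i : i \in I3. Proof. by rewrite -enumI3 mem_enum. Qed.
Lemma mem_I4 i : i \in I4. Proof. by rewrite -enumI4 mem_enum. Qed.

Lemma forall_I3 (P : 'I_3 -> Prop) : P o0 -> P o1 -> P o2 -> forall i, P i.
Proof. by move=> P0 P1 P2 i; move: (mem_I3 i); rewrite !inE => /or3P[] /eqP->. Qed.

Lemma forall_I4 (P : 'I_4 -> Prop) :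
  P (@Ordinal 4 0 isT) -> P (@Ordinal 4 1 isT) -> P (@Ordinal 4 2 isT) ->
  P (@Ordinal 4 3 isT) -> forall t, P t.
Proof.
move=> P0 P1 P2 P3 t.
by move: (mem_I4 t); rewrite !inE => /or4P[] /eqP->.
Qed.

Section PermutedTuples.
Variable T : eqType.
Implicit Types (s t : 'S_3) (u v w : 3.-tuple T).

Definition permw s u : 3.-tuple T := [tuple tnth u (s i) | i < 3].

Lemma tnth_permw s u i : tnth (permw s u) i = tnth u (s i).
Proof. by rewrite tnth_mktuple. Qed.

Lemma permwM s t u : permw s (permw t u) = permw (s * t)%g u.
Proof. by apply: eq_from_tnth => i; rewrite !tnth_permw permM. Qed.

Lemma permw1 u : permw 1%g u = u.
Proof. by apply: eq_from_tnth => i; rewrite tnth_permw perm1. Qed.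

Lemma permwK s : cancel (@permw s) (permw s^-1%g).
Proof. by move=> u; rewrite permwM mulVg permw1. Qed.

Lemma permwVK s : cancel (permw s^-1%g) (@permw s).
Proof. by move=> u; rewrite permwM mulgV permw1. Qed.

Lemma permw_inj s : injective (@permw s).
Proof. exact: can_inj (permwK s). Qed.

End PermutedTuples.

(** A permutation is coded by its list of values, which turns sums over ['S_3] into sums over six
    concrete lists. *)
Definition perms3 : seq (seq nat) :=
  [:: [:: 0; 1; 2]; [:: 0; 2; 1]; [:: 1; 0; 2];
      [:: 1; 2; 0]; [:: 2; 0; 1]; [:: 2; 1; 0]]%N.

Definition code (s : 'S_3) : seq nat := [seq val (s i) | i : 'I_3].

Definition permute (T : Type) (l : seq nat) (u : seq T) : seq T :=
  if u is x :: _ then [seq nth x u i | i <- l] else [::].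

Lemma codeE s : code s = [:: val (s o0); val (s o1); val (s o2)].
Proof. by rewrite /code /image_mem enumI3. Qed.

Lemma code_inj : injective code.
Proof.
move=> s t; rewrite !codeE => -[/val_inj e0 /val_inj e1 /val_inj e2].
by apply/permP; elim/forall_I3.
Qed.

Lemma code_in s : code s \in perms3.
Proof.
have : uniq (code s).
  by rewrite /code map_inj_uniq ?enum_uniq // => i j /val_inj/perm_inj.
rewrite codeE; case: (s _) (s _) (s _) => [a Ha] [b Hb] [c Hc] /=.
by case: a Ha => [|[|[|]]] // _; case: b Hb => [|[|[|]]] // _;
   case: c Hc => [|[|[|]]].
Qed.

Lemma perm_codes : perm_eq [seq code s | s : 'S_3] perms3.
Proof.
have uniq_codes : uniq [seq code s | s : 'S_3].
  by rewrite map_inj_uniq ?enum_uniq //; exact: code_inj.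
apply: uniq_perm => //.
have [] // := uniq_min_size uniq_codes (s2 := perms3).
  by move=> _ /mapP[s _ ->]; apply: code_in.
by rewrite size_map -cardE card_Sn.
Qed.

Lemma codeP l : l \in perms3 -> exists s, code s = l.
Proof. by rewrite -(perm_mem perm_codes) => /mapP[s _ ->]; exists s. Qed.

Lemma sum_code (V : nmodType) (G : seq nat -> V) :
  \sum_(s : 'S_3) G (code s) = \sum_(l <- perms3) G l.
Proof. by rewrite -(perm_big _ perm_codes) big_map big_enum. Qed.

Lemma permute_code (T : eqType) (s : 'S_3) (u : 3.-tuple T) :
  permute (code s) u = permw s u.
Proof.
case: u => -[|x u] //= Hu; rewrite -map_comp.
by apply: eq_map => i /=; rewrite (tnth_nth x).
Qed.

(** * Coefficient vectors and linear substitutions *)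

Section Polynomials.
Variable F : fieldType.
Implicit Types (p q : Defs.Poly F) (u v w : 3.-tuple letter) (c : 'S_3 -> F)
  (g : 'I_4 -> 'M[F]_3).

Definition types u : 3.-tuple 'I_4 := [tuple (tnth u i).1 | i < 3].

Lemma tnth_types u i : tnth (types u) i = (tnth u i).1.
Proof. by rewrite tnth_mktuple. Qed.

Lemma val_types u : types u = [seq a.1 | a <- u] :> seq _.
Proof.
rewrite (_ : types u = map_tuple (fun a : letter => a.1) u) //.
by apply: eq_from_tnth => i; rewrite tnth_types tnth_map.
Qed.

Lemma types_permw s u : types (permw s u) = permw s (types u).
Proof. by apply: eq_from_tnth => i; rewrite !(tnth_permw, tnth_types). Qed.

Definition mono v : Defs.Poly F := [ffun x => (x == v)%:R].

Definition coords p u : 'S_3 -> F := fun s => p (permw s u).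
Definition spread c v : Defs.Poly F := \sum_s c s *: mono (permw s v).

Lemma spreadE c v x : spread c v x = \sum_s c s * (x == permw s v)%:R.
Proof. by rewrite /spread sum_ffunE; apply: eq_bigr => s _; rewrite !ffunE. Qed.

Lemma eq_spread c c' v : c =1 c' -> spread c v = spread c' v.
Proof. by move=> e; apply: eq_bigr => s _; rewrite e. Qed.

Lemma spread_lin I (r : seq I) (a : I -> F) (c : I -> 'S_3 -> F) v :
  spread (fun s => \sum_(i <- r) a i * c i s) v =
  \sum_(i <- r) a i *: spread (c i) v.
Proof.
rewrite /spread; under eq_bigr do rewrite scaler_suml.
rewrite exchange_big /=; apply: eq_bigr => i _.
by rewrite scaler_sumr; apply: eq_bigr => s _; rewrite scalerA.
Qed.

Lemma spreadZ a c v : spread (fun s => a * c s) v = a *: spread c v.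
Proof. by rewrite /spread scaler_sumr; apply: eq_bigr => s _; rewrite scalerA. Qed.

Lemma coords_permw p u s t : coords p (permw t u) s = coords p u (s * t)%g.
Proof. by rewrite /coords permwM. Qed.

Lemma coords_act g p u s :
  coords (act g p) u s =
  \sum_w (\prod_k subst_coef g (tnth u k) (tnth w k)) * coords p w s.
Proof.
rewrite /coords ffunE (reindex_inj (@permw_inj _ s)) /=.
apply: eq_bigr => w _; rewrite mulrC; congr (_ * _).
rewrite [RHS](reindex_inj (@perm_inj _ s)) /=.
by apply: eq_bigr => k _; rewrite !tnth_permw.
Qed.

(** A substitution works letter by letter and [spread] permutes places, so [c] passes through
    unchanged and only the word varies. *)
Lemma act_spread g c v :
  act g (spread c v) =
  \sum_w (\prod_k subst_coef g (tnth w k) (tnth v k)) *: spread c w.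
Proof.
apply/ffunP => x; rewrite ffunE sum_ffunE.
under eq_bigr do rewrite spreadE mulr_suml.
under [RHS]eq_bigr do rewrite ffunE spreadE [_ *: _]mulr_sumr.
rewrite exchange_big [RHS]exchange_big /=; apply: eq_bigr => s _.
rewrite (bigD1 (permw s v)) //= eqxx mulr1 [X in _ + X = _]big1 ?addr0; last first.
  by move=> w /negPf ->; rewrite mulr0 mul0r.
rewrite (bigD1 (permw s^-1%g x)) //= permwVK eqxx mulr1.
rewrite [X in _ = _ + X]big1 ?addr0; last first.
  move=> w Hw; rewrite (_ : (x == _) = false) ?mulr0 //.
  by apply: contraNF Hw => /eqP ->; rewrite permwK.
rewrite mulrC; congr (_ * _).
rewrite [RHS](reindex_inj (@perm_inj _ s)) /=.
by apply: eq_bigr => k _; rewrite !tnth_permw permK.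
Qed.

Lemma subst_coef_type g a b : subst_coef g a b != 0 -> a.1 = b.1.
Proof. rewrite /subst_coef; by case: (a.1 =P b.1) => // _; rewrite eqxx. Qed.

Lemma prod_subst_types g u v :
  \prod_k subst_coef g (tnth u k) (tnth v k) != 0 -> types u = types v.
Proof.
move=> /prodf_neq0 H; apply: eq_from_tnth => k; rewrite !tnth_types.
exact: subst_coef_type (H k isT).
Qed.

Lemma eq_tuple_prod n (T : eqType) (u v : n.-tuple T) :
  (u == v)%:R = \prod_i (tnth u i == tnth v i)%:R :> F.
Proof.
rewrite eqEtuple; case: forallP => [uv|/forallP/forallPn[i /negPf ne]].
  by rewrite big1 // => i _; rewrite uv.
by rewrite (bigD1 i) //= ne mul0r.
Qed.

Lemma code_nth (s : 'S_3) i : s i = inord (nth 0%N (code s) i).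
Proof.
rewrite (nth_map i) ?size_enum_ord ?ltn_ord // nth_ord_enum.
by rewrite inord_val.
Qed.

(** Ryser's inclusion-exclusion formula for a 3 by 3 permanent, over the nonempty sets of columns;
    the empty set contributes a product of empty sums. *)
Lemma permanent3 (a : 'I_3 -> 'I_3 -> F) :
  let m x0 x1 x2 :=
    \prod_j \sum_(k < 3) (nth false [:: x0; x1; x2] k)%:R * a j k in
  \sum_(s : 'S_3) \prod_j a j (s j) =
  m true true true - m true true false - m true false true
  - m false true true + m true false false + m false true false
  + m false false true.
Proof.
move=> m; under eq_bigr => s _ do under eq_bigr => j _ do rewrite code_nth.
rewrite (sum_code (fun l => \prod_j a j (inord (nth 0%N l j)))).
rewrite /perms3 !big_cons big_nil /m !big_ord_recl !big_ord0 /=.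
have -> : inord 0 = ord0 :> 'I_3 by apply: val_inj; rewrite /= inordK.
have -> : inord 1 = lift ord0 ord0 :> 'I_3 by apply: val_inj; rewrite /= inordK.
have -> : inord 2 = lift ord0 (lift ord0 ord0) :> 'I_3.
  by apply: val_inj; rewrite /= inordK.
ring.
Qed.

(** * Singular substitutions and polarization inside a submodule *)

Section Submodules.
Variable S : Defs.Poly F -> Prop.
Hypothesis Smod : submodule S.

Lemma submodD p q : S p -> S q -> S (p + q).
Proof. by case: Smod => _ + _ _; apply. Qed.

Lemma submodZ a p : S p -> S (a *: p).
Proof. by case: Smod => _ _ + _; apply. Qed.

Lemma submodB p q : S p -> S q -> S (p - q).
Proof. by move=> Sp Sq; apply: submodD => //; rewrite -scaleN1r; apply: submodZ. Qed.

Lemma submod_sum I (r : seq I) (P : pred I) (p : I -> Defs.Poly F) :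
  (forall i, P i -> S (p i)) -> S (\sum_(i <- r | P i) p i).
Proof. by move=> Sp; apply: big_ind => //; [case: Smod | exact: submodD]. Qed.

Hypothesis char0 : [pchar F] =i pred0.

Lemma natF_eq0 n : (n%:R == 0 :> F) = (n == 0%N).
Proof. exact: (pcharf0P F).1. Qed.

Lemma natF_inj : injective (fun n => n%:R : F).
Proof.
move=> m n; wlog le_mn : m n / (m <= n)%N.
  by case/orP: (leq_total m n) => le_mn H e; [|apply/esym]; apply: H.
move=> /esym/eqP; rewrite -subr_eq0 -natrB // natF_eq0 subn_eq0 => le_nm.
by apply/eqP; rewrite eqn_leq le_mn.
Qed.

(** A shift is singular only if [- j.+1%:R * a] is an eigenvalue of [g t], that is, only if [a] is a
    root of one factor of [P]. In characteristic 0 the numbers 0, 1, ... are distinct in F, and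
    [size P] of them are too many to be all roots of a nonzero [P]. *)
Lemma exists_shift_unit g :
  exists a : F, forall t (j : 'I_4), g t + (j.+1%:R * a)%:M \in unitmx.
Proof.
pose P : {poly F} := \prod_t \prod_(j < 4)
  (char_poly (g t) \Po ((- j.+1%:R) *: 'X)).
have Pn0 : P != 0.
  apply/prodf_neq0 => t _; apply/prodf_neq0 => j _.
  rewrite comp_poly_eq0 ?monic_neq0 ?char_poly_monic //.
  by rewrite size_scale ?size_polyX // oppr_eq0 natF_eq0.
pose rs := [seq i%:R : F | i <- iota 0 (size P)].
have /allPn[a _ Pa] : ~~ all (root P) rs.
  apply/negP => /(max_poly_roots Pn0); rewrite size_map size_iota ltnn.
  by rewrite (map_inj_uniq natF_inj) iota_uniq => /(_ isT).
exists a => t j; apply: contraR Pa => sing.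
have : eigenvalue (g t) (- j.+1%:R * a).
  rewrite /eigenvalue /eigenspace kermx_eq0 row_free_unit.
  by rewrite mulNr raddfN opprK.
rewrite eigenvalue_root_char /root => /eqP cp0.
rewrite horner_prod (bigD1 t) //= horner_prod (bigD1 j) //=.
by rewrite horner_comp hornerZ hornerX cp0 !mul0r.
Qed.

(* [act g p] is cubic in g and fourth finite differences of a cubic vanish, so
   it is a combination of values at invertible translates of g. *)
Lemma submod_act g p : S p -> S (act g p).
Proof.
move=> Sp; have [a a_unit] := exists_shift_unit g.
pose q (j : 'I_4) := act (fun t => g t + (j.+1%:R * a)%:M) p.
have Sq j : S (q j).
  by case: Smod => _ _ _; apply => // t; apply: a_unit.
have -> : act g p = 4%:R *: q (inord 0) - 6%:R *: q (inord 1)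
                  + 4%:R *: q (inord 2) - q (inord 3).
  apply/ffunP => w; rewrite !ffunE !scaler_sumr -sumrB -big_split -sumrB /=.
  apply: eq_bigr => u _; rewrite !big_ord_recl !big_ord0 !inordK //.
  have E j k : subst_coef (fun t => g t + (j%:R * a)%:M) (tnth w k) (tnth u k)
      = subst_coef g (tnth w k) (tnth u k) +
        j%:R * (a * subst_coef (fun=> 1%:M) (tnth w k) (tnth u k)).
    rewrite /subst_coef; case: eqP => _; last by rewrite !mulr0 addr0.
    by rewrite !mxE !mulr_natr mulrnAr.
  rewrite !E /GRing.scale /=; ring.
apply: submodB => //; apply: submodD; last exact: submodZ.
by apply: submodB; apply: submodZ.
Qed.

(* [spread (coords p u) v] is the coefficient of x_0 x_1 x_2 in the image of p
   under the (singular) substitution sending u_k to x_k v_k; it is extracted by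
   inclusion-exclusion over x in {0,1}^3. *)
Lemma submod_spread_coords p u v :
  types u = types v -> S p -> S (spread (coords p u) v).
Proof.
move=> uv Sp.
pose a w u' j k : F :=
  (tnth w j == tnth v k)%:R * (tnth u' j == tnth u k)%:R.
pose g (x : 'I_3 -> bool) t : 'M[F]_3 := \matrix_(i, j)
  \sum_k (x k)%:R * (((t, i) == tnth v k)%:R * ((t, j) == tnth u k)%:R).
have gE x w u' j : subst_coef (g x) (tnth w j) (tnth u' j) =
    \sum_k (x k)%:R * a w u' j k.
  rewrite /subst_coef /a; case: (tnth w j) => t i; case: (tnth u' j) => t' i' /=.
  case: eqP => [<-|ne]; first by rewrite mxE.
  rewrite big1 // => k _; case: eqP => [e|]; last by rewrite mul0r mulr0.
  case: eqP => [e'|]; last by rewrite !mulr0.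
  by case: ne; rewrite -[t]/((t, i).1) e -[t']/((t', i').1) e' -!tnth_types uv.
pose q x0 x1 x2 := act (g (fun k : 'I_3 => nth false [:: x0; x1; x2] k)) p.
have Sq x0 x1 x2 : S (q x0 x1 x2) by apply: submod_act.
have -> : spread (coords p u) v =
    q true true true - q true true false - q true false true
    - q false true true + q true false false + q false true false
    + q false false true.
  apply/ffunP => w; rewrite spreadE !ffunE -!(sumrB, big_split) /=.
  (* The middle expression contains the permanent of [a w u']: its term for s equals 1 exactly when
     w and u' are the rearrangements by s of v and u. *)
  transitivity (\sum_u' p u' * \sum_(s : 'S_3) \prod_j a w u' j (s j)).
    under [RHS]eq_bigr do rewrite mulr_sumr.
    rewrite exchange_big; apply: eq_bigr => s _ /=.
    have E u' : \prod_j a w u' j (s j) =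
        (w == permw s v)%:R * (u' == permw s u)%:R.
      rewrite !eq_tuple_prod -big_split /=.
      by apply: eq_bigr => j _; rewrite !tnth_permw.
    rewrite (bigD1 (permw s u)) //= E eqxx mulr1 big1 ?addr0 // => u' ne.
    by rewrite E (negPf ne) !mulr0.
  apply: eq_bigr => u' _; rewrite permanent3 !(mulrDr, mulrN).
  do !congr (_ + _); do ?congr (- _); congr (_ * _);
    by apply: eq_bigr => j _; rewrite gE.
by do 3! apply: submodD => //; do 3! apply: submodB => //.
Qed.

End Submodules.
End Polynomials.

(** * Identities of M_{1,2} *)

Section Identities.
Variable F : fieldType.
Implicit Types (p q : Defs.Poly F) (u v w : 3.-tuple letter) (c : 'S_3 -> F)
  (g : 'I_4 -> 'M[F]_3) (t : 'I_4).

Lemma partM_lin t a (A B : 'M[F]_3) : partM t A -> partM t B -> partM t (a *: A + B).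
Proof.
have starD : star (a *: A + B) = a *: star A + star B.
  by apply/matrixP => i j; rewrite !mxE; case: i j => [[|[|?]] ?] [[|[|?]] ?] /=;
     rewrite !mxE ?opprD ?mulrN.
case=> partA starA [partB starB]; split; last first.
  by rewrite starD starA starB; case: odd; rewrite ?opprD ?scalerN.
case: ifP partA partB => _ partA partB i j ij;
  by rewrite !mxE partA // partB // mulr0 addr0.
Qed.

Lemma partM0 t : partM t (0 : 'M[F]_3).
Proof.
split; first by case: ifP => _ i j _; rewrite mxE.
have -> : star (0 : 'M[F]_3) = 0.
  apply/matrixP => i j; rewrite !mxE.
  by case: i j => [[|[|?]] ?] [[|[|?]] ?] /=; rewrite mxE ?oppr0.
by case: ifP; rewrite ?oppr0.
Qed.

Definition tuple_of_ffun n (T : finType) (f : {ffun 'I_n -> T}) : n.-tuple T :=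
  [tuple f i | i < n].

Lemma tuple_of_ffun_bij n (T : finType) :
  {on [pred x : n.-tuple T | true], bijective (@tuple_of_ffun n T)}.
Proof.
exists (fun u : n.-tuple T => [ffun i => tnth u i]).
  by move=> f _; apply/ffunP => i; rewrite ffunE tnth_mktuple.
by move=> u _; apply: eq_from_tnth => i; rewrite tnth_mktuple ffunE.
Qed.

Lemma prod_sum_scale (T : finType) n (A : algType F)
    (a : 'I_n -> T -> F) (M : 'I_n -> T -> A) :
  \prod_k \sum_b a k b *: M k b =
  \sum_(w : n.-tuple T) (\prod_k a k (tnth w k)) *: \prod_k M k (tnth w k).
Proof.
rewrite bigA_distr_bigA (reindex _ (tuple_of_ffun_bij n T)) /=.
apply: eq_bigr => f _; rewrite scaler_prod.
by congr (_ *: _); apply: eq_bigr => k _; rewrite tnth_mktuple.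
Qed.

Lemma evalP_act g p s :
  evalP s (act g p) = evalP (fun a => \sum_b subst_coef g b a *: s b) p.
Proof.
rewrite /evalP; under eq_bigr do rewrite ffunE scaler_suml.
rewrite exchange_big; apply: eq_bigr => u _ /=.
rewrite (prod_sum_scale (fun k b => subst_coef g b (tnth u k)) (fun _ b => s b)).
by rewrite scaler_sumr; apply: eq_bigr => w _; rewrite scalerA.
Qed.

Lemma evalPD s p q : evalP s (p + q) = evalP s p + evalP s q.
Proof.
by rewrite -big_split; apply: eq_bigr => w _; rewrite ffunE scalerDl.
Qed.

Lemma evalPZ s a p : evalP s (a *: p) = a *: evalP s p.
Proof.
by rewrite scaler_sumr; apply: eq_bigr => w _; rewrite ffunE scalerA.
Qed.

Lemma submodule_isId : submodule (@isId F).
Proof.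
split=> [s _|p q Ip Iq s Hs|a p Ip s Hs|g p _ Ip s Hs].
- by apply: big1 => w _; rewrite ffunE scale0r.
- by rewrite evalPD Ip // Iq // addr0.
- by rewrite evalPZ Ip // scaler0.
rewrite evalP_act; apply: Ip => a.
rewrite (bigID (fun b : letter => b.1 == a.1)) /= [X in _ + X]big1 ?addr0; last first.
  by move=> b /negPf ne; rewrite /subst_coef ne scale0r.
rewrite -big_filter.
(* Each letter goes to a combination of letters of its own type, whose values lie in one part; that
   part is a linear subspace. *)
elim: (filter _ _) (filter_all (fun b : letter => b.1 == a.1) (index_enum _)) =>
  [|b r IH] /=.
  by rewrite big_nil => _; apply: partM0.
by case/andP=> /eqP ba Hr; rewrite big_cons; apply: partM_lin (IH Hr); rewrite -ba.
Qed.

Lemma submodule_inW n : submodule (@inW F n).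
Proof.
split=> [w|p q Wp Wq w|a p Wp w|g p _ Wp w].
- by rewrite ffunE eqxx.
- rewrite ffunE; have [->|/Wp //] := eqVneq (p w) 0.
  by rewrite add0r => /Wq.
- by rewrite ffunE /GRing.scale /= mulf_eq0 negb_or => /andP[_ /Wp].
rewrite ffunE => nz t.
have [u] : exists u, p u * \prod_k subst_coef g (tnth w k) (tnth u k) != 0.
  apply/existsP; apply: contraR nz; rewrite negb_exists => /forallP z.
  by rewrite big1 // => u _; apply/eqP; move: (z u); rewrite negbK.
rewrite mulf_eq0 negb_or => /andP[/Wp/(_ t) <- /prod_subst_types].
have countE v : count (fun a : letter => a.1 == t) v = count_mem t (types v).
  by rewrite val_types count_map.
by rewrite !countE => ->.
Qed.

Lemma evalP_mono s v : evalP s (mono F v) = \prod_k s (tnth v k).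
Proof.
rewrite /evalP (bigD1 v) //= [X in _ + X]big1 => [|w /negPf ne].
  by rewrite ffunE eqxx scale1r addr0.
by rewrite ffunE ne scale0r.
Qed.

Lemma evalP_spread s c v :
  evalP s (spread c v) = \sum_t c t *: \prod_k s (tnth v (t k)).
Proof.
have eval_sum I (r : seq I) (f : I -> Defs.Poly F) :
    evalP s (\sum_(i <- r) f i) = \sum_(i <- r) evalP s (f i).
  apply: (big_morph _ (evalPD s)); apply: big1 => w _.
  by rewrite ffunE scale0r.
rewrite eval_sum; apply: eq_bigr => t _; rewrite evalPZ evalP_mono.
by congr (_ *: _); apply: eq_bigr => k _; rewrite tnth_permw.
Qed.

(** Three indices per type allow a word [v] with the types of [u] and pairwise distinct letters.
    Polarizing onto [v] gives a multilinear identity, in which the matrices [A k] can be chosen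
    independently even if [u] repeats letters. *)
Lemma isId_coords p u (A : 'I_3 -> 'M[F]_3) :
    [pchar F] =i pred0 -> isId p -> (forall k, partM (tnth u k).1 (A k)) ->
  \sum_s coords p u s *: \prod_k A (s k) = 0.
Proof.
move=> char0 Ip partA.
pose v : 3.-tuple letter := [tuple ((tnth u i).1, i) | i < 3].
have vk k : tnth v k = ((tnth u k).1, k) by rewrite tnth_mktuple.
have uv : types u = types v.
  by apply: eq_from_tnth => k; rewrite !tnth_types vk.
(* Letters outside [v] are sent to 0, which belongs to every part. *)
pose s (a : letter) : 'M[F]_3 := if a == tnth v a.2 then A a.2 else 0.
have sv k : s (tnth v k) = A k by rewrite /s vk /= -vk eqxx.
have parts a : partM a.1 (s a).
  rewrite /s; case: eqP => [e|_]; last exact: partM0.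
  by rewrite e vk; apply: partA.
have /(_ s parts) := submod_spread_coords submodule_isId char0 uv Ip.
rewrite evalP_spread; under eq_bigr do under eq_bigr do rewrite sv.
by [].
Qed.

End Identities.

(** * From highest weight data to decompositions *)

Section Decomposition.
Variables (F : fieldType) (char0 : [pchar F] =i pred0).
Variables (n : seq nat) (ty : 3.-tuple 'I_4).
Hypothesis tyP : forall t : 'I_4, count_mem t ty = nth 0%N n t.
Implicit Types (p q : Defs.Poly F) (u v w : 3.-tuple letter) (c : 'S_3 -> F).

Lemma inWP p : inW n p <->
  forall w, p w != 0 -> exists s, types w = permw s ty.
Proof.
have countE w t : count (fun a : letter => a.1 == t) w = count_mem t (types w).
  by rewrite val_types count_map.
split=> [Wp w /Wp cnt|H w /H[s e] t]; last first.
  rewrite countE -tyP e; apply/seq.permP; apply/tuple_permP; exists s.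
  by [].
have /tuple_permP[s e] : perm_eq (types w) ty.
  by apply/allP => t _ /=; rewrite -countE cnt tyP.
by exists s; apply: val_inj.
Qed.

Definition stab := #|[pred s : 'S_3 | permw s ty == ty]|.

Lemma stab_gt0 : (0 < stab)%N.
Proof. by apply/card_gt0P; exists 1%g; rewrite inE permw1. Qed.

(** A word x occurring in [p] is a rearrangement of a word of types [ty] in exactly [stab] ways: the
    word is determined by the permutation, and the admissible permutations form a coset of the
    stabilizer of [ty]. *)
Lemma restitution p : inW n p ->
  stab%:R *: p = \sum_(u | types u == ty) spread (coords p u) u.
Proof.
move=> Wp; apply/ffunP => x; rewrite ffunE sum_ffunE.
under eq_bigr do rewrite spreadE.
rewrite exchange_big /=.
have E s : \sum_(u | types u == ty) coords p u s * (x == permw s u)%:R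
    = p x * (permw s^-1%g (types x) == ty)%:R.
  rewrite -types_permw; have [e|ne] := boolP (types _ == ty).
    rewrite (bigD1 (permw s^-1%g x)) //= /coords permwVK eqxx big1 ?addr0 //.
    move=> u /andP[_ ne]; rewrite (_ : (x == _) = false) ?mulr0 //.
    by apply: contraNF ne => /eqP ->; rewrite permwK.
  rewrite mulr0 big1 // => u tyu; rewrite (_ : (x == _) = false) ?mulr0 //.
  by apply: contraNF ne => /eqP ->; rewrite permwK.
under eq_bigr do rewrite E.
rewrite -mulr_sumr /GRing.scale /= mulrC.
have [->|nz] := eqVneq (p x) 0; first by rewrite !mul0r.
have [s e] := (inWP p).1 Wp x nz; congr (_ * _).
(* This change of variable carries the coset to the stabilizer itself. *)
rewrite e (reindex_inj (h := fun t : 'S_3 => (s * t^-1)%g)); last first.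
  by move=> t t' /mulgI/invg_inj.
rewrite -natr_sum /stab -sum1_card [in LHS]big_mkcond; congr (_%:R).
apply: eq_bigr => t _; rewrite permwM invMg invgK mulgKV inE.
by case: eqP.
Qed.

Definition dot (a c : 'S_3 -> F) : F := \sum_s a s * c s.

Lemma dot_sumr I (r : seq I) (b : I -> F) (c : I -> 'S_3 -> F) a :
  dot a (fun s => \sum_(i <- r) b i * c i s) = \sum_(i <- r) b i * dot a (c i).
Proof.
rewrite /dot; under eq_bigr do rewrite mulr_sumr.
rewrite exchange_big; apply: eq_bigr => i _ /=; rewrite mulr_sumr.
by apply: eq_bigr => s _; rewrite mulrCA.
Qed.

Lemma dotZr a b c : dot a (fun s => b * c s) = b * dot a c.
Proof. by rewrite /dot mulr_sumr; apply: eq_bigr => s _; rewrite mulrCA. Qed.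

Lemma eq_dot a c c' : c =1 c' -> dot a c = dot a c'.
Proof. by move=> e; apply: eq_bigr => s _; rewrite e. Qed.

(* The S_3-side of the module generated by [hw_poly] is spanned by the vectors
   b_i read off along the rearrangements [hw_perm i] of the leading word;
   [hw_dual i] is dual to b_i up to the factor [den], and [hw_proj i] is an
   element of the group algebra sending b_i to [den] times the leading vector and
   killing the other b_j, which yields irreducibility. *)
Record hw_data := HwData {
  hw_poly : Defs.Poly F;
  hw_word : 3.-tuple letter;
  hw_dim : nat;
  hw_perm : nat -> 'S_3;
  hw_dual : nat -> 'S_3 -> F;
  hw_proj : nat -> seq (F * 'S_3) }.

Implicit Type d : hw_data.

Definition hw_lead d := coords (hw_poly d) (hw_word d).
Definition hw_vec d i := coords (hw_poly d) (permw (hw_perm d i) (hw_word d)).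

Variable den : F.
Hypothesis den_neq0 : den != 0.

Definition proj_span d c s :=
  \sum_(i < hw_dim d) dot (hw_dual d i) c * hw_vec d i s.

Definition vanishing c := forall A : 'I_3 -> 'M[F]_3,
  (forall k, partM (tnth ty k) (A k)) -> \sum_s c s *: \prod_k A (s k) = 0.

(** Finitely many conditions on one generator. [hw_span] puts its vectors along all words of types
    [ty] in the span of the b_i; [hw_projE] describes right translations, which amount to reading
    along a permuted word; [hw_top] treats the words that an upper unitriangular substitution can
    create from the leading word. *)
Record hw_axioms d : Prop := HwAxioms {
  hw_types : types (hw_word d) = ty;
  hw_neq0 : hw_poly d != 0;
  hw_spread : exists2 a, a != 0 & spread (hw_lead d) (hw_word d) = a *: hw_poly d;
  hw_permP : forall i, (i < hw_dim d)%N -> permw (hw_perm d i) ty = ty;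
  hw_span : forall u, types u = ty -> forall s,
    den * coords (hw_poly d) u s = proj_span d (coords (hw_poly d) u) s;
  hw_projP : forall i, (i < hw_dim d)%N ->
    forall x, x \in hw_proj d i -> permw x.2 ty = ty;
  hw_projE : forall i j, (i < hw_dim d)%N -> (j < hw_dim d)%N -> forall s,
    \sum_(x <- hw_proj d i) x.1 * hw_vec d j (s * x.2)%g =
    if i == j then den * hw_lead d s else 0;
  hw_top : forall w, types w = ty ->
    (forall k, ((tnth w k).2 <= (tnth (hw_word d) k).2)%N) ->
    w != hw_word d -> spread (hw_lead d) w = 0;
  hw_van : vanishing (hw_lead d) }.

(** * The module generated by one highest weight vector *)

Section Generated.
Variables (d : hw_data) (ax : hw_axioms d).
Let f := hw_poly d.

Lemma gen_submodule (S : Defs.Poly F -> Prop) p :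
  submodule S -> S f -> gen f p -> S p.
Proof. by move=> Smod Sf; apply. Qed.

Lemma submodule_gen : submodule (gen f).
Proof.
split=> [S [] //|p q gp gq S Smod Sf|a p gp S Smod Sf|g p Ug gp S Smod Sf].
- by apply: submodD => //; [apply: gp | apply: gq].
- by apply: submodZ => //; apply: gp.
- by apply: submod_act => //; apply: gp.
Qed.

Lemma scaled_mem (S : Defs.Poly F -> Prop) a p :
  submodule S -> a != 0 -> S (a *: p) -> S p.
Proof.
by move=> Smod a0 Sp; rewrite -[p](scalerK a0); apply: submodZ.
Qed.

Lemma mem_spread_lead (S : Defs.Poly F -> Prop) :
  submodule S -> S (spread (hw_lead d) (hw_word d)) -> S f.
Proof.
move=> Smod; have [a a0 ->] := hw_spread ax.
exact: scaled_mem.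
Qed.

Lemma isId_hw : isId f.
Proof.
apply: (mem_spread_lead (@submodule_isId F)) => s Hs.
rewrite evalP_spread.
apply: (hw_van ax (A := fun k => s (tnth (hw_word d) k))) => k.
by rewrite -(hw_types ax) tnth_types.
Qed.

Lemma inW_hw : inW n f.
Proof.
apply: (mem_spread_lead (@submodule_inW F n)).
apply/inWP => w; rewrite spreadE => nz.
have [s] : exists s, hw_lead d s * (w == permw s (hw_word d))%:R != 0.
  apply/existsP; apply: contraR nz; rewrite negb_exists => /forallP z.
  by rewrite big1 // => s _; apply/eqP; move: (z s); rewrite negbK.
have [-> _|] := eqVneq w (permw s (hw_word d)); last by rewrite mulr0 eqxx.
by exists s; rewrite types_permw (hw_types ax).
Qed.

Lemma gen_isId_inW p : gen f p -> isId p /\ inW n p.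
Proof.
move=> gp; split; first exact: gen_submodule (@submodule_isId F) isId_hw gp.
exact: gen_submodule (@submodule_inW F n) inW_hw gp.
Qed.

(** By [coords_act], the vector of [act g q] along a word is a combination of vectors of [q] along
    words of the same types. Lying in the span of the b_i is therefore a submodule property, and it
    holds for the generator by [hw_span]. *)
Lemma gen_span p u : gen f p -> types u = ty ->
  forall s, den * coords p u s = proj_span d (coords p u) s.
Proof.
move=> gp.
pose S q := forall u, types u = ty ->
  forall s, den * coords q u s = proj_span d (coords q u) s.
suff Smod : submodule S by apply: (gen_submodule Smod (hw_span ax) gp).
(* The hypothesis is restricted to nonzero coefficients because [coords_act] sums over all words,
   and only those of types [ty] are under control. *)
have span_lin I (r : seq I) (b : I -> F) (c : I -> 'S_3 -> F) :
    (forall i s, b i != 0 -> den * c i s = proj_span d (c i) s) ->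
  forall s, den * (\sum_(i <- r) b i * c i s) =
    proj_span d (fun s => \sum_(i <- r) b i * c i s) s.
  move=> H s; rewrite /proj_span; under [RHS]eq_bigr do rewrite dot_sumr mulr_suml.
  rewrite exchange_big mulr_sumr; apply: eq_bigr => i _ /=.
  have [->|b0] := eqVneq (b i) 0.
    by rewrite mul0r mulr0 big1 // => j _; rewrite !mul0r.
  rewrite mulrCA H // mulr_sumr; apply: eq_bigr => j _.
  by rewrite mulrA.
split=> [v _ s|p1 p2 S1 S2 v tv s|a q Sq v tv s|g q _ Sq v tv s].
- rewrite /coords ffunE mulr0 /proj_span big1 // => i _.
  by rewrite /dot big1 ?mul0r // => t _; rewrite ffunE mulr0.
- have := span_lin _ [:: true; false] (fun=> 1)
    (fun b => coords (if b then p1 else p2) v).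
  move=> /(_ _ s); rewrite !big_cons big_nil !mul1r addr0.
  rewrite /coords ffunE => -> ; last by case=> t _; [apply: S1 | apply: S2].
  rewrite /proj_span; apply: eq_bigr => i _; congr (_ * _); apply: eq_dot => t.
  by rewrite !big_cons big_nil !mul1r addr0 ffunE.
- have := span_lin _ [:: tt] (fun=> a) (fun=> coords q v).
  move=> /(_ _ s); rewrite big_seq1 /coords ffunE => ->; last by move=> _ t _; apply: Sq.
  rewrite /proj_span; apply: eq_bigr => i _; congr (_ * _); apply: eq_dot => t.
  by rewrite big_seq1 ffunE.
rewrite coords_act span_lin => [|w t /prod_subst_types e]; last first.
  by apply: Sq; rewrite -e.
rewrite /proj_span; apply: eq_bigr => i _; congr (_ * _); apply: eq_dot => t.
by rewrite coords_act.
Qed.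

(** A nonzero element of [S] has a nonzero vector along some word of types [ty], hence a nonzero
    coefficient at some b_i. The group algebra element [hw_proj d i] isolates that term and turns it
    into the leading vector, which returns [f]. *)
Lemma irreducible_hw : irreducible_gen f.
Proof.
move=> S Smod Sgen.
(* [S] is an arbitrary predicate, so the choice between zero and nonzero submodules is classical. *)
have [[p [Sp p0]]|none] := classic (exists p, S p /\ p != 0); last first.
  by left=> p Sp; have [//|p0] := eqVneq p 0; case: none; exists p.
right=> q gq; apply: (gq S Smod).
have [w pw] : exists w, p w != 0.
  apply/existsP; apply: contraR p0; rewrite negb_exists => /forallP z.
  by apply/eqP/ffunP => w; rewrite ffunE; apply/eqP; move: (z w); rewrite negbK.
have [s tw] := (inWP p).1 (gen_isId_inW (Sgen _ Sp)).2 w pw.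
pose u := permw s^-1%g w.
have tu : types u = ty by rewrite types_permw tw permwK.
have span := gen_span (Sgen _ Sp) tu.
have [i ai] : exists i : 'I_(hw_dim d), dot (hw_dual d i) (coords p u) != 0.
  apply/existsP; apply: contraR pw; rewrite negb_exists => /forallP z.
  rewrite -(mulrI_eq0 _ (mulfI den_neq0)).
  rewrite (_ : p w = coords p u s) ?span; last by rewrite /coords permwVK.
  apply/eqP; apply: big1 => i _; move: (z i); rewrite negbK => /eqP ->.
  by rewrite mul0r.
(* The group algebra element acts inside [S] by reading [p] along permuted words and spreading each
   result on the leading word. *)
pose q' := \sum_(x <- hw_proj d i) x.1 *: spread (coords p (permw x.2 u)) (hw_word d).
have Sq' : S q'.
  rewrite /q' big_seq; apply: submod_sum => // x xi; apply: submodZ => //.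
  apply: submod_spread_coords => //.
  by rewrite types_permw tu (hw_types ax) (hw_projP ax (ltn_ord i)).
apply: mem_spread_lead => //; apply: (scaled_mem Smod ai).
apply: (scaled_mem Smod den_neq0).
rewrite scalerA -spreadZ.
suff -> : spread (fun t => den * dot (hw_dual d i) (coords p u) * hw_lead d t)
    (hw_word d) = den *: q' by apply: submodZ.
rewrite /q' -spread_lin -spreadZ; apply: eq_spread => t.
rewrite mulr_sumr.
under eq_bigr do rewrite mulrCA coords_permw span mulr_sumr.
rewrite exchange_big /= (bigD1 i) //= [X in _ = _ + X]big1 ?addr0.
  under eq_bigr do rewrite mulrCA.
  by rewrite -mulr_sumr (hw_projE ax) // eqxx mulrA [den * _]mulrC.
move=> j ji; under eq_bigr do rewrite mulrCA.
rewrite -mulr_sumr (hw_projE ax) // ifN ?mulr0 //.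
by apply: contraNN ji => /eqP/val_inj ->.
Qed.

(** Apply [act_spread] to a multiple of [f] written as a spread on the leading word. For a diagonal
    [g] only the leading word survives, with the weight as factor. For a unitriangular [g] it keeps
    factor 1, and another word needs indices bounded by the leading ones, since entries below the
    diagonal vanish; [hw_top] removes these words. *)
Lemma hwv_hw lam :
    (forall e : letter -> F, \prod_k e (tnth (hw_word d) k) =
      \prod_(t < 4) \prod_(i < 3) e (t, i) ^+ nth 0%N (nth [::] lam t) i) ->
  hwv lam f.
Proof.
move=> wt; have [a a0 spr] := hw_spread ax; split; first exact: hw_neq0.
- move=> e _; apply: (scalerI a0).
  transitivity (act (fun t => diag_mx (\row_i e t i)) (a *: f)).
    apply/ffunP => w; rewrite !ffunE scaler_sumr; apply: eq_bigr => u _.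
    by rewrite ffunE /GRing.scale /= mulrA.
  rewrite -spr act_spread (bigD1 (hw_word d)) //= [X in _ + X]big1 ?addr0.
    rewrite spr !scalerA mulrC; congr (_ *: _); congr (_ * _).
    rewrite -(wt (fun b => e b.1 b.2)); apply: eq_bigr => k _.
    by rewrite /subst_coef eqxx !mxE eqxx mulr1n.
  move=> w; rewrite eqEtuple => /forallPn[k ne].
  rewrite (bigD1 k) //= /subst_coef; case: eqP => [e1|]; last by rewrite mul0r scale0r.
  rewrite !mxE; case: eqP => [e2|]; last by rewrite mulr0n mul0r scale0r.
  by move: ne; rewrite [tnth w k]surjective_pairing e1 e2 -surjective_pairing eqxx.
move=> g ug; apply: (scalerI a0).
transitivity (act g (a *: f)).
  apply/ffunP => w; rewrite !ffunE scaler_sumr; apply: eq_bigr => u _.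
  by rewrite ffunE /GRing.scale /= mulrA.
rewrite -spr act_spread (bigD1 (hw_word d)) //= [X in _ + X]big1 ?addr0.
  rewrite big1 ?scale1r // => k _.
  by rewrite /subst_coef eqxx (ug _).1.
move=> w ne; set b := \prod_(k < 3) _.
have [->|nz] := eqVneq b 0; first by rewrite scale0r.
rewrite (hw_top ax) ?scaler0 //.
  by rewrite (prod_subst_types nz) (hw_types ax).
move=> k; rewrite leqNgt; apply/negP => lt; case/negP: nz.
rewrite /b (bigD1 k) //= /subst_coef; case: ((tnth w k).1 =P _) => _; last by rewrite mul0r.
by rewrite (ug _).2 ?mul0r.
Qed.

End Generated.

(** * Several generated modules: spanning and independence *)

Variables (K : nat) (D : nat -> hw_data).
Hypothesis axD : forall k, (k < K)%N -> hw_axioms (D k).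
Hypothesis orthoD : forall k l, (k < K)%N -> (l < K)%N -> k != l ->
  forall i j, (i < hw_dim (D k))%N -> (j < hw_dim (D l))%N ->
  dot (hw_dual (D k) i) (hw_vec (D l) j) = 0.
Hypothesis completeD : forall c, vanishing c ->
  forall s, den * c s = \sum_(k < K) proj_span (D k) c s.

(** Restitution rebuilds [p] from its vectors along words of types [ty], and completeness splits
    these vectors over the modules. Each b_i is a vector of the generator along such a word, so by
    polarization its spread on any [u] stays in the generated module. *)
Lemma sum_gen p : isId p -> inW n p ->
  exists ps : nat -> Defs.Poly F,
    (forall k, (k < K)%N -> gen (hw_poly (D k)) (ps k)) /\
    p = \sum_(k < K) ps k.
Proof.
move=> Ip Wp.
have m0 : den * stab%:R != 0.
  by rewrite mulf_neq0 // natF_eq0 // -lt0n stab_gt0.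
pose ps k := (den * stab%:R)^-1 *: \sum_(u | types u == ty)
  spread (proj_span (D k) (coords p u)) u.
exists ps; split=> [k kK|].
  apply: (submodZ (submodule_gen (D k))); apply: submod_sum => [|u /eqP tu].
    exact: submodule_gen.
  rewrite /proj_span spread_lin; apply: submod_sum => [|i _].
    exact: submodule_gen.
  apply: (submodZ (submodule_gen (D k))).
  apply: (submod_spread_coords (submodule_gen (D k))) => //.
  by rewrite types_permw (hw_types (axD kK)) (hw_permP (axD kK)).
apply: (scalerI m0); rewrite -scaler_sumr scalerA mulfV // scale1r.
rewrite -scalerA restitution // scaler_sumr exchange_big /=.
apply: eq_bigr => u /eqP tu; rewrite -spreadZ.
have van : vanishing (coords p u).
  move=> A partA; apply: isId_coords => // k.
  by rewrite -tnth_types tu.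
rewrite (eq_spread _ (completeD van)).
rewrite (eq_spread (c' := fun s => \sum_(k < K) 1 * proj_span (D k) (coords p u) s)).
  by rewrite spread_lin; apply: eq_bigr => k _; rewrite scale1r.
by move=> s; apply: eq_bigr => k _; rewrite mul1r.
Qed.

(** A dual vector of module k kills the vectors of all other modules. Pairing it with the zero sum
    therefore isolates a coefficient of [ps k], and these coefficients determine [ps k]. *)
Lemma gen_independent (ps : nat -> Defs.Poly F) :
    (forall k, (k < K)%N -> gen (hw_poly (D k)) (ps k)) ->
    \sum_(k < K) ps k = 0 ->
  forall k, (k < K)%N -> ps k = 0.
Proof.
move=> gps sum0 k kK; apply/ffunP => w; rewrite ffunE; apply/eqP.
apply: contraT => nz.
have [s tw] := (inWP _).1 (gen_isId_inW (axD kK) (gps k kK)).2 w nz.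
pose u := permw s^-1%g w.
have tu : types u = ty by rewrite types_permw tw permwK.
have span l (lK : (l < K)%N) := gen_span (axD lK) (gps l lK) tu.
case/negP: nz; rewrite -(mulrI_eq0 _ (mulfI den_neq0)).
rewrite (_ : ps k w = coords (ps k) u s); last by rewrite /coords permwVK.
rewrite span //; apply/eqP; apply: big1 => i _.
suff -> : dot (hw_dual (D k) i) (coords (ps k) u) = 0 by rewrite mul0r.
have : dot (hw_dual (D k) i) (coords (\sum_(l < K) ps l) u) = 0.
  rewrite sum0 /dot big1 // => t _; by rewrite /coords ffunE mulr0.
have e : coords (\sum_(l < K) ps l) u =1
    fun t => \sum_(l < K) 1 * coords (ps l) u t.
  by move=> t; rewrite /coords sum_ffunE; apply: eq_bigr => l _; rewrite mul1r.
rewrite (eq_dot _ e) dot_sumr (bigD1 (Ordinal kK)) //= mul1r big1 ?addr0 // => l lk.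
rewrite mul1r; apply: (mulfI den_neq0); rewrite mulr0 -dotZr.
rewrite (eq_dot _ (span l (ltn_ord l))) dot_sumr big1 // => j _.
rewrite orthoD ?mulr0 //; apply: contraNN lk => /eqP kl.
exact/eqP/val_inj.
Qed.

End Decomposition.

(** * Integer certificates *)

(* Big operators are locked, whereas the integer checks must compute. *)
Definition sumz (I : Type) (r : seq I) (f : I -> int) : int :=
  foldr (fun x a => f x + a) 0 r.

Arguments sumz : simpl never.

Lemma sumzE I (r : seq I) f : sumz r f = \sum_(x <- r) f x.
Proof. by rewrite unlock. Qed.

Lemma intr_sum (R : pzRingType) I (r : seq I) (P : pred I) (f : I -> int) :
  (\sum_(x <- r | P x) f x)%:~R = \sum_(x <- r | P x) (f x)%:~R :> R.
Proof. exact: (big_morph _ (intrD R) (mulr0z 1)). Qed.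

Fixpoint expand (e : ncexpr) : seq (int * seq letter) :=
  match e with
  | EVar a => [:: (1, [:: a])]
  | EAdd p q => expand p ++ expand q
  | EOpp p => [seq (- x.1, x.2) | x <- expand p]
  | EMul p q => [seq (x.1 * y.1, x.2 ++ y.2) | x <- expand p, y <- expand q]
  end.

Definition coefz (p : seq (int * seq letter)) (w : seq letter) : int :=
  sumz p (fun x => if x.2 == w then x.1 else 0).

(** Convolution of two monomials: only the cut after [size u] letters can contribute. *)
Lemma sum_split (R : pzSemiRingType) (T : eqType) (u v w : seq T) :
  \sum_(i < (size w).+1) (u == take i w)%:R * (v == drop i w)%:R =
  (u ++ v == w)%:R :> R.
Proof.
have E (i : 'I_(size w).+1) : (u == take i w)%:R * (v == drop i w)%:R =
    ((i == size u :> nat) && (u ++ v == w))%:R :> R.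
  rewrite -natrM mulnb; congr (nat_of_bool _)%:R; apply/andP/andP.
    by case=> /eqP -> /eqP ->; rewrite cat_take_drop size_takel // -ltnS.
  by case=> /eqP -> /eqP <-; rewrite take_size_cat // drop_size_cat.
under eq_bigr do rewrite E.
case: eqP => [e|_]; last by apply: big1 => i _; rewrite andbF.
have lt_uw : (size u < (size w).+1)%N by rewrite ltnS -e size_cat leq_addr.
rewrite (bigD1 (Ordinal lt_uw)) //= eqxx [X in _ + X]big1 ?addr0 // => i ne.
by rewrite andbT; case: eqP => // ie; case/eqP: ne; apply: val_inj.
Qed.

Lemma coefzE (F : fieldType) e w : coef F e w = (coefz (expand e) w)%:~R.
Proof.
have coefzE' p u : (coefz p u)%:~R =
    \sum_(x <- p) x.1%:~R * (x.2 == u)%:R :> F.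
  rewrite /coefz sumzE intr_sum; apply: eq_bigr => x _.
  by case: eqP; rewrite ?mulr1 ?mulr0.
elim: e w => [a|p IHp q IHq|p IHp|p IHp q IHq] w; rewrite coefzE' /=.
- by rewrite big_seq1 mul1r eq_sym.
- by rewrite big_cat -!coefzE' IHp IHq.
- by rewrite IHp coefzE' big_map -sumrN; apply: eq_bigr => x _; rewrite mulrNz mulNr.
rewrite big_allpairs_dep /=; under eq_bigr do rewrite IHp IHq !coefzE' mulr_suml.
rewrite exchange_big; apply: eq_bigr => x _ /=.
under eq_bigr do rewrite mulr_sumr.
rewrite exchange_big; apply: eq_bigr => y _ /=.
rewrite -sum_split mulr_sumr; apply: eq_bigr => i _.
by rewrite mulrACA intrM.
Qed.

Definition vecz := seq nat -> int.
(** Vectors are tabulated in the order of [perms3]. *)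
Definition vec_of (s : seq int) : vecz := fun l => nth 0 s (index l perms3).
Definition dotz (a b : vecz) : int := sumz perms3 (fun l => a l * b l).
Definition coordsz (p : seq (int * seq letter)) (u : seq letter) : vecz :=
  vec_of [seq coefz p (permute l u) | l <- perms3].

Lemma coordszE e u l : l \in perms3 -> coordsz e u l = coefz e (permute l u).
Proof.
by move=> lP; rewrite /coordsz /vec_of (nth_map l) ?index_mem ?nth_index.
Qed.

Lemma coordsE (F : fieldType) e (u : 3.-tuple letter) s :
  coords (poly_of F e) u s = (coordsz (expand e) u (code s))%:~R.
Proof. by rewrite coordszE ?code_in // /coords ffunE coefzE permute_code. Qed.

Lemma dotzE (F : fieldType) (a b : vecz) :
  (dotz a b)%:~R = dot (fun s => (a (code s))%:~R) (fun s => (b (code s))%:~R) :> F.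
Proof.
rewrite /dotz sumzE intr_sum -sum_code.
by apply: eq_bigr => s _; rewrite intrM.
Qed.

Definition decode (l : seq nat) : 'S_3 := odflt 1%g [pick s | code s == l].

Lemma decodeK l : l \in perms3 -> code (decode l) = l.
Proof.
move=> /codeP[s e]; rewrite /decode; case: pickP => [t /eqP //|/(_ s)].
by rewrite e eqxx.
Qed.

Lemma permute_decode (T : eqType) l (u : 3.-tuple T) :
  l \in perms3 -> permute l u = permw (decode l) u.
Proof. by move=> lP; rewrite -permute_code decodeK. Qed.

(* Indexed by letter type; missing third basis matrices read as 0. *)
Definition part_basis : seq (seq (seq (seq int))) :=
  [:: [:: [:: [:: 1; 0; 0]; [:: 0; 0; 0]; [:: 0; 0; 0]];
          [:: [:: 0; 0; 0]; [:: 0; 1; 0]; [:: 0; 0; 1]]];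
      [:: [:: [:: 0; 0; 0]; [:: 0; 1; 0]; [:: 0; 0; -1]];
          [:: [:: 0; 0; 0]; [:: 0; 0; 1]; [:: 0; 0; 0]];
          [:: [:: 0; 0; 0]; [:: 0; 0; 0]; [:: 0; 1; 0]]];
      [:: [:: [:: 0; 1; 0]; [:: 0; 0; 0]; [:: -1; 0; 0]];
          [:: [:: 0; 0; 1]; [:: 1; 0; 0]; [:: 0; 0; 0]]];
      [:: [:: [:: 0; 1; 0]; [:: 0; 0; 0]; [:: 1; 0; 0]];
          [:: [:: 0; 0; 1]; [:: -1; 0; 0]; [:: 0; 0; 0]]]].

Definition basisz (t q i j : nat) : int :=
  nth 0 (nth [::] (nth [::] (nth [::] part_basis t) q) i) j.

(** * Reduction of the vanishing conditions to basis matrices *)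

Section Basis.
Variables (F : fieldType) (char0 : [pchar F] =i pred0).

Definition basis_mx (t q : nat) : 'M[F]_3 := \matrix_(i, j) (basisz t q i j)%:~R.

Lemma partM_basis (t : 'I_4) (q : 'I_3) : partM t (basis_mx t q).
Proof.
split.
  by elim/forall_I4: t; elim/forall_I3: q => /=; elim/forall_I3; elim/forall_I3;
     rewrite mxE.
apply/matrixP => i j; rewrite mxE /= !inord_smallE.
elim/forall_I4: t; elim/forall_I3: q => /=; elim/forall_I3: i; elim/forall_I3: j;
  by rewrite /= ?mxE -?mulrNz.
Qed.

Lemma partM_span (t : 'I_4) (A : 'M[F]_3) : partM t A ->
  exists x : 'I_3 -> F, A = \sum_q x q *: basis_mx t q.
Proof.
case=> parA /matrixP starA.
have eq0 (x : F) : - x = x -> x = 0.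
  move/eqP; rewrite -subr_eq0 -opprD oppr_eq0 -mulr2n -mulr_natl mulf_eq0.
  by rewrite natF_eq0 // => /eqP.
have {}starA a b := starA a b.
(* The coordinates are entries of [A]; the symmetry equations of [star] give the remaining entries,
   and [eq0] kills those equal to their own negatives. *)
exists (fun q => if t == 0%N :> nat then nth 0 [:: A o0 o0; A o1 o1] q
                 else if t == 1%N :> nat then nth 0 [:: A o1 o1; A o1 o2; A o2 o1] q
                 else nth 0 [:: A o0 o1; A o0 o2] q).
have := (starA o0 o0, starA o0 o1, starA o0 o2, starA o1 o0, starA o1 o1,
         starA o1 o2, starA o2 o0, starA o2 o1, starA o2 o2).
rewrite !mxE /= !inord_smallE.
elim/forall_I4: t parA starA => /= par _; rewrite ?mxE;
  case=> [[[[[[[[e00 e01] e02] e10] e11] e12] e20] e21] e22];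
  apply/matrixP;
  elim/forall_I3; elim/forall_I3;
  rewrite summxE !big_ord_recl big_ord0 !mxE /= /basisz /=
    ?mulr0z ?mulrN1z ?mulr1z ?mulr0 ?mulrN ?mulr1 ?add0r ?addr0 //;
  by first [exact: par | exact: eq0 e12 | exact: eq0 e21 | exact: eq0 (esym e00)
           | exact: e11 | exact: e02 | exact: esym e20
           | exact: esym (oppr_inj e20)].
Qed.

Variable ty : 3.-tuple 'I_4.

Lemma vanishing_basis (c : 'S_3 -> F) :
    (forall q : {ffun 'I_3 -> 'I_3},
      \sum_s c s *: \prod_k basis_mx (tnth ty (s k)) (q (s k)) = 0) ->
  vanishing ty c.
Proof.
move=> c0 A partA.
have [x xE] : exists x : 'I_3 -> 'I_3 -> F,
    forall k, A k = \sum_q x k q *: basis_mx (tnth ty k) q.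
  have [x0 e0] := partM_span (partA o0).
  have [x1 e1] := partM_span (partA o1).
  have [x2 e2] := partM_span (partA o2).
  by exists (fun k => nth x0 [:: x0; x1; x2] k); elim/forall_I3.
have E (s : 'S_3) : \prod_k A (s k) = \sum_(q : {ffun 'I_3 -> 'I_3})
    (\prod_k x k (q k)) *: \prod_k basis_mx (tnth ty (s k)) (q (s k)).
  under eq_bigr do rewrite xE.
  rewrite bigA_distr_bigA.
  (* Distributivity indexes the chosen basis matrices by place; composing with [s] indexes them by
     letter, so that one [q] serves all permutations. *)
  rewrite (reindex (fun q : {ffun 'I_3 -> 'I_3} => [ffun k => q (s k)])) /=.
    apply: eq_bigr => q _; rewrite scaler_prod; congr (_ *: _); last first.
      by apply: eq_bigr => k _; rewrite ffunE.
    rewrite [RHS](reindex_inj (@perm_inj _ s)) /=.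
    by apply: eq_bigr => k _; rewrite ffunE.
  exists (fun q : {ffun 'I_3 -> 'I_3} => [ffun k => q (s^-1%g k)]) => q _;
    by apply/ffunP => k; rewrite !ffunE ?permK ?permKV.
under eq_bigr do rewrite E scaler_sumr.
rewrite exchange_big big1 //= => q _.
under eq_bigr do rewrite scalerA mulrC -scalerA.
by rewrite -scaler_sumr c0 scaler0.
Qed.

(** Entry (i, j) of the product of basis matrices rearranged by [l], as a functional on F[S_3]; [q]
    chooses the matrix of each letter, not of each place. *)
Definition thetaz (ts q : seq nat) (i j : nat) : vecz := fun l =>
  let M k := basisz (nth 0%N ts (nth 0%N l k)) (nth 0%N q (nth 0%N l k)) in
  sumz (iota 0 3) (fun a => sumz (iota 0 3) (fun b => M 0%N i a * M 1%N a b * M 2%N b j)).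

Lemma thetazE (q : 'I_3 -> nat) (s : 'S_3) (i j : 'I_3) :
  (\prod_k basis_mx (tnth ty (s k)) (q (s k))) i j =
  (thetaz [seq val t | t <- ty] [seq q k | k <- I3] i j (code s))%:~R.
Proof.
have nth_code k : nth 0%N (code s) (val k) = s k.
  by rewrite (nth_map k) ?size_enum_ord ?ltn_ord // nth_ord_enum.
have nth_q k : nth 0%N [seq q k | k <- I3] (val k) = q k.
  by elim/forall_I3: k.
have nth_ty k : nth 0%N [seq val t | t <- ty] (val k) = tnth ty k.
  by rewrite (nth_map ord0) ?size_tuple ?ltn_ord // (tnth_nth ord0).
pose M k := basis_mx (tnth ty (s k)) (q (s k)).
have ME k a b : M k a b = (basisz (nth 0%N [seq val t | t <- ty] (nth 0%N (code s) k))
    (nth 0%N [seq q k | k <- I3] (nth 0%N (code s) k)) a b)%:~R.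
  by rewrite mxE nth_code nth_q nth_ty.
rewrite 3!big_ord_recl big_ord0 mulr1 -!/(M _).
rewrite /thetaz !sumzE intr_sum -[iota 0 3]/(index_iota 0 3) big_mkord.
rewrite mxE; apply: eq_bigr => a _.
rewrite [X in _ * X]mxE mulr_sumr sumzE intr_sum big_mkord.
by apply: eq_bigr => b _; rewrite !ME -mulrA !intrM.
Qed.

End Basis.

(** * Certificate format and computable checks *)

Record gen_row := GenRow {
  gen_perm : seq nat;
  gen_dual : seq int;
  gen_proj : seq (int * seq nat) }.

Record equation := Equation {
  eq_index : seq nat;
  eq_entry : nat * nat;
  eq_coef : seq int }.

Definition no_row := GenRow [::] [::] [::].

Definition type_word (n : seq nat) : seq 'I_4 :=
  flatten [seq nseq (nth 0%N n t) t | t : 'I_4 <- I4].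

(** The leading word: the sorted monomial of weight [lam]. *)
Definition weight_word (lam : seq (seq nat)) : seq letter :=
  flatten [seq flatten [seq nseq (nth 0%N (nth [::] lam t) i) (t, i) | i : 'I_3 <- I3]
          | t : 'I_4 <- I4].

Fixpoint words (ts : seq 'I_4) : seq (seq letter) :=
  if ts is t :: ts' then [seq (t, i) :: w | i <- I3, w <- words ts'] else [:: [::]].

Lemma mem_words w : w \in words [seq a.1 | a <- w].
Proof.
elim: w => // -[t i] w IH; apply/allpairsP; exists (i, w); split=> //.
exact: mem_I3.
Qed.

Fixpoint power (T : Type) (s : seq T) n : seq (seq T) :=
  if n is n'.+1 then [seq x :: w | x <- s, w <- power s n'] else [:: [::]].

Lemma mem_power (T : eqType) (s w : seq T) :
  {subset w <= s} -> w \in power s (size w).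
Proof.
elim: w => // x w IH sub; apply/allpairsP; exists (x, w); split=> //=.
  by apply: sub; rewrite mem_head.
by apply: IH => y yw; apply: sub; rewrite in_cons yw orbT.
Qed.

(** A common denominator: the duals involve fractions such as 1/2, 1/3, 1/4, 1/6, the equations also
    1/12 and 5/12. *)
Definition denz : int := 12.

Definition vectors (p : seq (int * seq letter)) v (rows : seq gen_row) : seq (vecz * vecz) :=
  [seq (vec_of (gen_dual r), coordsz p (permute (gen_perm r) v)) | r <- rows].

(** If [v] repeats letters, each rearrangement arises from several permutations. The last two
    conditions make the spread of the leading vector equal to the polynomial times the number of
    permutations fixing [v]. *)
Definition check_lead (p : seq (int * seq letter)) (v : seq letter) : bool :=
  let c := coordsz p v in
  [&& has (fun l => c l != 0) perms3,
   all (fun x => has (fun l => x.2 == permute l v) perms3) p &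
   all (fun k => (count (fun l => permute l v == v) perms3)%:Z * c k ==
      sumz perms3 (fun l => if permute k v == permute l v then c l else 0)) perms3].

Definition check_rows (ty : seq 'I_4) rows : bool :=
  all (fun r => [&& gen_perm r \in perms3, permute (gen_perm r) ty == ty &
    all (fun x => (x.2 \in perms3) && (permute x.2 ty == ty)) (gen_proj r)]) rows.

Definition check_span ty p (vs : seq (vecz * vecz)) : bool :=
  all (fun u => let c := coordsz p u in
    all (fun l => denz * c l == sumz vs (fun x => dotz x.1 c * x.2 l)) perms3)
    (words ty).

Definition check_proj p v rows : bool :=
  all (fun i => all (fun j =>
    let cs := [seq (x.1, coordsz p (permute x.2 (permute (gen_perm (nth no_row rows j)) v)))
              | x <- gen_proj (nth no_row rows i)] in
    let c := coordsz p v in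
    all (fun l => sumz cs (fun x => x.1 * x.2 l) == if i == j then denz * c l else 0)
   perms3) (iota 0 (size rows))) (iota 0 (size rows)).

Definition check_top (ty : seq 'I_4) p v : bool :=
  let c := coordsz p v in
  all (fun w => all2 (fun a b : letter => (a.2 <= b.2)%N) w v ==> (w != v) ==>
    all (fun k => sumz perms3 (fun l =>
      if permute k w == permute l w then c l else 0) == 0) perms3) (words ty).

Definition check_van (ty : seq 'I_4) p v : bool :=
  let c := coordsz p v in let ts := [seq val t | t <- ty] in
  all (fun q => all (fun i => all (fun j => dotz c (thetaz ts q i j) == 0)
    (iota 0 3)) (iota 0 3)) (power (iota 0 3) 3%N).

Definition check_hw (ty : seq 'I_4) (e : ncexpr) (lam : seq (seq nat)) rows : bool :=
  let p := expand e in let v := weight_word lam in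
  [&& [seq a.1 | a <- v] == ty, check_lead p v, check_rows ty rows,
      check_span ty p (vectors p v rows), check_proj p v rows,
      check_top ty p v & check_van ty p v].

Definition check_ortho (vss : seq (seq (vecz * vecz))) : bool :=
  all (fun k => all (fun l => (k != l) ==>
    all (fun x => all (fun y => dotz x.1 y.2 == 0) (nth [::] vss l)) (nth [::] vss k))
    (iota 0 (size vss))) (iota 0 (size vss)).

(* Certifies [denz * id = sum b_i dual_i^T + sum eq_coef theta^T], where every
   theta is an entry of a product of basis matrices, hence vanishes on the
   coordinate vectors of identities. *)
Definition check_complete (ts : seq nat) (vss : seq (seq (vecz * vecz)))
    (eqs : seq equation) : bool :=
  let ths := [seq (vec_of (eq_coef y),
                   thetaz ts (eq_index y) (eq_entry y).1 (eq_entry y).2) | y <- eqs] in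
  all (fun y => [&& size (eq_index y) == 3%N, all (fun a => (a < 3)%N) (eq_index y),
                    ((eq_entry y).1 < 3)%N & ((eq_entry y).2 < 3)%N]) eqs &&
  all (fun l => all (fun l' =>
    sumz vss (fun vs => sumz vs (fun x => x.1 l' * x.2 l)) +
    sumz ths (fun x => x.1 l * x.2 l') == if l' == l then denz else 0) perms3) perms3.

Definition default_term : ncexpr * seq (seq nat) := (EVar (ord0, ord0), [::]).

Definition check (n : seq nat) (L : seq (ncexpr * seq (seq nat)))
    (cert : seq (seq gen_row)) (eqs : seq equation) : bool :=
  let ty := type_word n in
  let vss := [seq vectors (expand x.1.1) (weight_word x.1.2) x.2 | x <- zip L cert] in
  [&& size ty == 3%N, size cert == size L,
   all (fun t : 'I_4 => count_mem t ty == nth 0%N n t) I4,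
   all (fun x => check_hw ty x.1.1 x.1.2 x.2) (zip L cert),
   check_ortho vss & check_complete [seq val t | t <- ty] vss eqs].

(** For weights whose partitions are single rows or columns: type-preserving permutations multiply
    the leading vector by a sign, so it spans alone, and the projector is [denz] times the
    identity. *)
Definition line (a : seq int) : seq gen_row :=
  [:: GenRow [:: 0; 1; 2]%N a [:: (12, [:: 0; 1; 2]%N)]].

(* The group algebra elements act as matrix units on the representation (2,1). *)
Definition hook (a b : seq int) : seq gen_row :=
  [:: GenRow [:: 0; 1; 2]%N a
        [:: (4, [:: 0; 1; 2]%N); (4, [:: 0; 2; 1]%N);
            (8, [:: 1; 0; 2]%N); (-4, [:: 1; 2; 0]%N)];
      GenRow [:: 0; 2; 1]%N b
        [:: (-4, [:: 0; 1; 2]%N); (8, [:: 0; 2; 1]%N);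
            (4, [:: 1; 0; 2]%N); (-8, [:: 1; 2; 0]%N)]].

(** * Soundness of the checks over any field of characteristic zero *)

Section Soundness.
Variables (F : fieldType) (char0 : [pchar F] =i pred0).

Lemma intF_eq0 (z : int) : (z%:~R == 0 :> F) = (z == 0).
Proof.
case: z => k; first by rewrite natF_eq0.
by rewrite NegzE mulrNz !oppr_eq0 natF_eq0.
Qed.

Definition data_of (e : ncexpr) (v : 3.-tuple letter) (rows : seq gen_row) : hw_data F :=
  let r i := nth no_row rows i in
  HwData (poly_of F e) v (size rows) (fun i => decode (gen_perm (r i)))
    (fun i s => (vec_of (gen_dual (r i)) (code s))%:~R)
    (fun i => [seq (x.1%:~R, decode x.2) | x <- gen_proj (r i)]).

Lemma perms3P (P : pred (seq nat)) : all P perms3 -> forall s, P (code s).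
Proof. by move=> /allP H s; apply: H; apply: code_in. Qed.

Lemma coords_decode e (v : 3.-tuple letter) l s : l \in perms3 ->
  coords (poly_of F e) (permw (decode l) v) s =
  (coordsz (expand e) (permute l v) (code s))%:~R.
Proof. by move=> lP; rewrite coordsE permute_decode. Qed.

Lemma intr_if (b : bool) (z : int) : (if b then z else 0)%:~R = z%:~R * b%:R :> F.
Proof. by case: b; rewrite ?mulr1 ?mulr0. Qed.

Lemma mem_words_types (u : 3.-tuple letter) : val u \in words (types u).
Proof. by rewrite val_types; apply: mem_words. Qed.

Lemma hw_vecE ty e v rows i s : check_rows ty rows -> (i < size rows)%N ->
  hw_vec (data_of e v rows) i s =
  (coordsz (expand e) (permute (gen_perm (nth no_row rows i)) v) (code s))%:~R.
Proof.
move=> /(all_nthP no_row) rowsP lt; rewrite /hw_vec coords_decode //.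
by have /and3P[] := rowsP _ lt.
Qed.

Section Data.
Variables (ty : 3.-tuple 'I_4) (e : ncexpr) (v : 3.-tuple letter) (rows : seq gen_row).
Let p := expand e.
Hypothesis ty_v : types v = ty.

Lemma sum_permute (c : vecz) (u w : 3.-tuple letter) :
  (sumz perms3 (fun l => if (val u : seq letter) == permute l w then c l else 0))%:~R
  = \sum_s (c (code s))%:~R * (u == permw s w)%:R :> F.
Proof.
rewrite sumzE intr_sum -sum_code; apply: eq_bigr => s _.
by rewrite permute_code -intr_if.
Qed.

Lemma check_lead_neq0 : check_lead p v -> poly_of F e != 0.
Proof.
case/and3P=> /hasP[l lP nz] _ _; have [s sl] := codeP lP.
apply: contraNneq nz => e0; rewrite -intF_eq0 -sl -coordsE /coords e0.
by rewrite ffunE.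
Qed.

Lemma check_lead_spread : check_lead p v ->
  exists2 a, a != 0 &
    spread (coords (poly_of F e) v) v = a *: poly_of F e.
Proof.
case/and3P=> _ /allP monos /perms3P lead.
pose m := count (fun l => permute l v == v) perms3.
exists m%:R.
  rewrite natF_eq0 // -lt0n -has_count; apply/hasP; exists (code 1%g).
    exact: code_in.
  by rewrite permute_code permw1.
apply/ffunP => x; rewrite spreadE.
under eq_bigr do rewrite coordsE.
have [/existsP[k /eqP xk]|/existsPn no] := boolP [exists k, x == permw k v].
  have /eqP := lead k; rewrite -/m => /(congr1 (fun z => z%:~R : F)).
  rewrite intrM permute_code sum_permute -xk => <-.
  by rewrite -coordsE /coords -xk [RHS]ffunE.
rewrite big1 => [|s _]; last by rewrite (negPf (no s)) mulr0.
rewrite ffunE [poly_of _ _ _]ffunE coefzE (_ : coefz _ _ = 0) ?scaler0 //.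
rewrite /coefz sumzE big_seq big1 // => y yp; case: eqP => // yx.
have /hasP[l lP /eqP ly] := monos y yp; have [s sl] := codeP lP.
have := no s; rewrite -val_eqE /= -permute_code sl -ly yx.
by rewrite eqxx.
Qed.

Lemma check_hwP : check_lead p v -> check_rows ty rows ->
  check_span ty p (vectors p v rows) -> check_proj p v rows ->
  check_top ty p v -> check_van ty p v ->
  hw_axioms ty denz%:~R (data_of e v rows).
Proof.
move=> lead rows_ok; have vecE i s := hw_vecE e v s rows_ok (i := i).
move: rows_ok; rewrite /check_rows /check_span /check_proj /check_top /check_van; cbv zeta.
move=> /(all_nthP no_row) rowsP /allP span /allP proj /allP top /allP van.
split=> //=.
- exact: check_lead_neq0.
- exact: check_lead_spread.
- move=> i lt; have /and3P[lP /eqP fix_ty _] := rowsP _ lt.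
  by apply: val_inj; rewrite /= -permute_decode.
- move=> u tu s; have := mem_words_types u; rewrite tu => /span.
  move=> /perms3P/(_ s)/eqP/(congr1 (fun z => z%:~R : F)).
  rewrite intrM -coordsE => ->.
  rewrite sumzE intr_sum big_map (big_nth no_row) big_mkord /proj_span.
  apply: eq_bigr => i _; rewrite intrM dotzE vecE //=; congr (_ * _).
  by apply: eq_bigr => t _; rewrite coordsE.
- move=> i lt x /mapP[y yP ->] /=.
  have /and3P[_ _ /allP/(_ y yP)/andP[lP /eqP fix_ty]] := rowsP _ lt.
  by apply: val_inj; rewrite /= -permute_decode.
- move=> i j lti ltj s.
  have iI : i \in iota 0 (size rows) by rewrite mem_iota.
  have jI : j \in iota 0 (size rows) by rewrite mem_iota.
  have /allP/(_ j jI)/perms3P/(_ s)/eqP := proj i iI.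
  move=> /(congr1 (fun z => z%:~R : F)).
  rewrite sumzE intr_sum !big_map => eq_ij.
  transitivity (if i == j then (denz * coordsz p v (code s))%:~R else 0 : F); last first.
    by case: eqP => // _; rewrite intrM /hw_lead coordsE.
  rewrite (_ : (if i == j then _ else 0) =
      (if i == j then denz * coordsz p v (code s) else 0)%:~R :> F); last by case: eqP.
  rewrite -eq_ij big_seq [RHS]big_seq; apply: eq_bigr => x xP /=.
  have /and3P[_ _ /allP/(_ x xP)/andP[lP _]] := rowsP _ lti.
  rewrite intrM; congr (_ * _).
  rewrite /hw_vec -coords_permw coords_decode // -permute_decode //.
  by have /and3P[] := rowsP _ ltj.
- move=> w tw le ne; apply/ffunP => x; rewrite ffunE spreadE /hw_lead /=.
  have := mem_words_types w; rewrite tw => /top.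
  have -> : all2 (fun a b : letter => (a.2 <= b.2)%N) w v.
    rewrite all2E !size_tuple eqxx /=; apply/(all_nthP ((ord0, ord0), (ord0, ord0))).
    move=> i; rewrite size_zip !size_tuple minnn => lt.
    by rewrite nth_zip ?size_tuple //= -!(tnth_nth _ _ (Ordinal lt)).
  have -> : (val w != val v) by [].
  move=> /perms3P zero.
  have [/existsP[k /eqP xk]|/existsPn no] := boolP [exists k, x == permw k w].
    have /eqP := zero k; rewrite permute_code => /(congr1 (fun z => z%:~R : F)).
    rewrite sum_permute -xk => e0; rewrite -[RHS]e0.
    by apply: eq_bigr => s _; rewrite coordsE.
  by rewrite big1 // => s _; rewrite (negPf (no s)) mulr0.
apply: (vanishing_basis char0) => q.
apply/matrixP => i j; rewrite summxE mxE.
pose qs := [seq val (q k) | k <- I3].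
have qsP : qs \in power (iota 0 3) 3%N.
  have := mem_power (s := iota 0 3) (w := qs); rewrite size_map; apply.
  by move=> _ /mapP[k _ ->]; rewrite mem_iota /=.
have ord_iota (k : 'I_3) : val k \in iota 0 3 by rewrite mem_iota /=.
have /allP/(_ _ (ord_iota i))/allP/(_ _ (ord_iota j))/eqP := van qs qsP.
move=> /(congr1 (fun z => z%:~R : F)); rewrite dotzE => e0; rewrite -[RHS]e0.
apply: eq_bigr => s _; rewrite mxE (thetazE F ty (fun k => val (q k)) s i j) /hw_lead coordsE.
by [].
Qed.

End Data.

Lemma big_weight_word (e : letter -> F) lam :
  \prod_(a <- weight_word lam) e a =
  \prod_(t < 4) \prod_(i < 3) e (t, i) ^+ nth 0%N (nth [::] lam t) i.
Proof.
rewrite /weight_word big_flatten big_map -enumI4 big_enum; apply: eq_bigr => t _.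
rewrite big_flatten big_map -enumI3 big_enum; apply: eq_bigr => i _.
by rewrite big_nseq iter_mulr_1.
Qed.

Lemma vanishing_theta (ty : 3.-tuple 'I_4) (c : 'S_3 -> F) (q : seq nat) (i j : nat) :
    vanishing ty c -> size q = 3%N -> all (fun a => (a < 3)%N) q ->
    (i < 3)%N -> (j < 3)%N ->
  \sum_s (thetaz [seq val t | t <- ty] q i j (code s))%:~R * c s = 0.
Proof.
move=> van size_q q3 i3 j3.
have qE : q = [seq val (inord (nth 0%N q k) : 'I_3) | k : 'I_3 <- I3].
  case: q size_q q3 => [|a [|b [|d []]]] //= _ /and4P[a3 b3 d3 _].
  by rewrite !inordK.
have parts k : partM (tnth ty k) (basis_mx F (tnth ty k) (inord (nth 0%N q k) : 'I_3)).
  exact: partM_basis.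
have /matrixP/(_ (Ordinal i3) (Ordinal j3)) := van _ parts.
rewrite summxE [RHS]mxE => e0.
rewrite -[RHS]e0; apply: eq_bigr => s _; rewrite mxE.
rewrite (thetazE F ty (fun k => val (inord (nth 0%N q k) : 'I_3)) s) -qE /=.
by rewrite mulrC.
Qed.

Theorem decomp_check n L cert eqs : check n L cert eqs -> decomp F n L.
Proof.
case/and5P=> /eqP size_ty /eqP size_cert /allP tyP.
move=> /(all_nthP (default_term, [::])) hwL /andP[ortho complete].
pose ty : 3.-tuple 'I_4 := Tuple (introT eqP size_ty).
pose x0 : (ncexpr * seq (seq nat)) * seq gen_row := (default_term, [::]).
pose x k := nth x0 (zip L cert) k.
have x1 k : (k < size L)%N -> (x k).1 = nth default_term L k.
  move=> lt; rewrite /x nth_zip ?size_cert //.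
have xP k : (k < size L)%N -> check_hw ty (x k).1.1 (x k).1.2 (x k).2.
  by move=> lt; apply: hwL; rewrite size_zip size_cert minnn.
(* The default tuple occurs only for [k] out of range; otherwise the weight word has the length of
   [ty]. *)
pose word k : 3.-tuple letter := insubd (nseq_tuple 3 (ord0, ord0)) (weight_word (x k).1.2).
have wordE k : (k < size L)%N -> val (word k) = weight_word (x k).1.2.
  move=> /xP /andP[/eqP tv _]; apply: insubdK.
  by rewrite -topredE /= -(size_map (fun a : letter => a.1)) tv size_tuple.
pose D k := data_of (x k).1.1 (word k) (x k).2.
have den0 : denz%:~R != 0 :> F by rewrite intF_eq0.
have axD k : (k < size L)%N -> hw_axioms ty denz%:~R (D k).
  move=> lt; have := xP k lt; rewrite /check_hw -wordE //.
  case/and5P=> /eqP tv ? ? ? /and3P[*]; apply: check_hwP => //.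
  by apply: val_inj; apply: etrans (val_types _) tv.
have f_eq k : (k < size L)%N ->
    poly_of F (nth (EVar (0, 0), [::]) L k).1 = hw_poly (D k).
  by move=> lt; rewrite /D /= x1.
have rows_ok k : (k < size L)%N -> check_rows ty (x k).2.
  by move=> /xP/and5P[].
pose vs k := vectors (expand (x k).1.1) (weight_word (x k).1.2) (x k).2.
have vss_nth k : (k < size L)%N ->
    nth [::] [seq vectors (expand y.1.1) (weight_word y.1.2) y.2 | y <- zip L cert] k
    = vs k.
  by move=> lt; rewrite (nth_map x0) // size_zip size_cert minnn.
have dualE k i s : (i < size (x k).2)%N ->
    hw_dual (D k) i s = ((nth (fun=> 0, fun=> 0) (vs k) i).1 (code s))%:~R.
  by move=> lt; rewrite /vs /vectors (nth_map no_row).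
have vecE k i s : (k < size L)%N -> (i < size (x k).2)%N ->
    hw_vec (D k) i s = ((nth (fun=> 0, fun=> 0) (vs k) i).2 (code s))%:~R.
  move=> kL lt; rewrite (hw_vecE _ _ _ (rows_ok k kL)) // wordE //.
  by rewrite /vs /vectors (nth_map no_row).
have orthoD k l : (k < size L)%N -> (l < size L)%N -> k != l ->
  forall i j, (i < hw_dim (D k))%N -> (j < hw_dim (D l))%N ->
  dot (hw_dual (D k) i) (hw_vec (D l) j) = 0.
  move=> kL lL kl i j iD jD; move: ortho.
  rewrite /check_ortho size_map size_zip size_cert minnn.
  move=> /allP/(_ k); rewrite mem_iota kL => /(_ isT)/allP/(_ l).
  rewrite mem_iota lL kl !vss_nth //= => /(_ isT).
  move=> /(all_nthP (fun=> 0, fun=> 0))/(_ i); rewrite size_map => /(_ iD).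
  move=> /(all_nthP (fun=> 0, fun=> 0))/(_ j); rewrite size_map => /(_ jD)/eqP.
  move=> /(congr1 (fun z => z%:~R : F)); rewrite dotzE => e0; rewrite -[RHS]e0.
  by apply: eq_bigr => s _; rewrite -dualE // -vecE.
have completeD c : vanishing ty c ->
    forall s, denz%:~R * c s = \sum_(k < size L) proj_span (D k) c s.
  move=> van s; case/andP: complete => eqs_ok /perms3P/(_ s)/perms3P complete.
  (* Entry (s, t) of the certified matrix identity; multiplying by [c t] and summing over t leaves
     the module terms, because [vanishing_theta] removes the equations. *)
  have {}complete t : \sum_(k < size L) \sum_(i < size (x k).2)
        hw_dual (D k) i t * hw_vec (D k) i s +
      \sum_(y <- eqs) (vec_of (eq_coef y) (code s))%:~R *
        (thetaz [seq val t | t <- ty] (eq_index y) (eq_entry y).1 (eq_entry y).2 (code t))%:~R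
      = denz%:~R * (t == s)%:R.
    have /eqP := complete t; rewrite (inj_eq code_inj).
    move=> /(congr1 (fun z => z%:~R : F)); rewrite intr_if => <-.
    rewrite intrD !sumzE !intr_sum !big_map; congr (_ + _); last first.
      by apply: eq_bigr => y _; rewrite intrM.
    rewrite (big_nth x0) size_zip size_cert minnn big_mkord.
    apply: eq_bigr => k _; rewrite -/(x k) -/(vs k) sumzE intr_sum.
    rewrite (big_nth (fun=> 0, fun=> 0)) size_map big_mkord; apply: eq_bigr => i _.
    by rewrite intrM dualE // vecE.
  transitivity (\sum_t (denz%:~R * (t == s)%:R) * c t).
    rewrite (bigD1 s) //= eqxx mulr1 big1 ?addr0 // => t /negPf ->.
    by rewrite mulr0 mul0r.
  under eq_bigr do rewrite -complete mulrDl.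
  rewrite big_split /= [X in _ + X = _](_ : _ = 0) ?addr0; last first.
    under eq_bigr do rewrite mulr_suml.
    rewrite exchange_big /=.
    elim: eqs eqs_ok {complete} => [|y eqs' IH] /=; first by rewrite big_nil.
    case/andP=> /and4P[/eqP sz lt3 i3 j3] /IH; rewrite big_cons => ->.
    rewrite addr0; under eq_bigr do rewrite -mulrA.
    rewrite -mulr_sumr; apply/eqP; rewrite mulf_eq0; apply/orP; right; apply/eqP.
    exact: vanishing_theta van sz lt3 i3 j3.
  under eq_bigr do rewrite mulr_suml.
  rewrite exchange_big /=; apply: eq_bigr => k _.
  under eq_bigr do rewrite mulr_suml.
  rewrite exchange_big /=; apply: eq_bigr => i _.
  by rewrite /dot mulr_suml; apply: eq_bigr => t _; rewrite mulrAC.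
have tyP' t : count_mem t ty = nth 0%N n t by apply/eqP/tyP/mem_I4.
split=> [k kL|q Iq Wq|ps gps sum0 k kL].
- rewrite f_eq //; split.
  + exact: (isId_hw (axD k kL)).
  + exact: (inW_hw tyP' (axD k kL)).
  + apply: (hwv_hw (axD k kL)) => w.
    by rewrite -x1 // -(big_tuple _ _ _ xpredT) wordE // big_weight_word.
  + exact: (irreducible_hw char0 tyP' den0 (axD k kL)).
  exact: (gen_isId_inW tyP' (axD k kL)).
- have [ps [gps ->]] := sum_gen char0 tyP' den0 axD completeD Iq Wq.
  by exists ps; split=> // k kL; rewrite f_eq //; apply: gps.
apply: (gen_independent tyP' den0 axD orthoD _ sum0 kL) => {kL}k kL.
by rewrite -f_eq //; apply: gps.
Qed.

End Soundness.

(** [inord] does not reduce, so the indices become explicit ordinals before evaluation. *)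
Ltac certify := rewrite /yp /ym /zp /zm !inord_smallE; vm_compute; reflexivity.

(* Weights are written [:: lambda(1); lambda(2); lambda(3); lambda(4)],
   with [::] the empty partition; compositions as [:: n1; n2; n3; n4]. *)
Theorem theorem4p7 (F : fieldType) (char0 : [pchar F] =i pred0) :
  (* (1) *)
  decomp F [:: 3; 0; 0; 0]%N
    [:: ((comm (yp 1) (yp 2) * yp 1)%nc, [:: [:: 2; 1]; [::]; [::]; [::]]%N);
        (comm (yp 1 * yp 1) (yp 2), [:: [:: 2; 1]; [::]; [::]; [::]]%N);
        (St3 (yp 1) (yp 2) (yp 3), [:: [:: 1; 1; 1]; [::]; [::]; [::]]%N)] /\
  (* (2) *)
  decomp F [:: 0; 3; 0; 0]%N
    [:: (comm (ym 1 * ym 1) (ym 2), [:: [::]; [:: 2; 1]; [::]; [::]]%N)] /\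
  (* (3) *)
  decomp F [:: 2; 1; 0; 0]%N
    [:: (comm (yp 1 * yp 1) (ym 1), [:: [:: 2]; [:: 1]; [::]; [::]]%N);
        (comm (yp 1) (ym 1 * yp 1), [:: [:: 2]; [:: 1]; [::]; [::]]%N);
        ((comm (yp 1) (yp 2) * ym 1)%nc, [:: [:: 1; 1]; [:: 1]; [::]; [::]]%N);
        ((yp 1 * ym 1 * yp 2 - yp 2 * ym 1 * yp 1)%nc,
           [:: [:: 1; 1]; [:: 1]; [::]; [::]]%N);
        ((ym 1 * comm (yp 1) (yp 2))%nc, [:: [:: 1; 1]; [:: 1]; [::]; [::]]%N)] /\
  (* (4) *)
  decomp F [:: 1; 2; 0; 0]%N
    [:: (comm (yp 1) (ym 1 * ym 1), [:: [:: 1]; [:: 2]; [::]; [::]]%N);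
        ((ym 1 * comm (yp 1) (ym 1))%nc, [:: [:: 1]; [:: 2]; [::]; [::]]%N);
        (comm (yp 1) (ym 1 * ym 2 - ym 2 * ym 1),
           [:: [:: 1]; [:: 1; 1]; [::]; [::]]%N);
        ((ym 1 * comm (yp 1) (ym 2) - ym 2 * comm (yp 1) (ym 1))%nc,
           [:: [:: 1]; [:: 1; 1]; [::]; [::]]%N)] /\
  (* (5) *)
  decomp F [:: 2; 0; 1; 0]%N
    [:: ((comm (yp 1) (yp 2) * zp 1)%nc, [:: [:: 1; 1]; [::]; [:: 1]; [::]]%N);
        ((zp 1 * comm (yp 1) (yp 2))%nc, [:: [:: 1; 1]; [::]; [:: 1]; [::]]%N)] /\
  (* (6) *)
  decomp F [:: 2; 0; 0; 1]%N
    [:: ((comm (yp 1) (yp 2) * zm 1)%nc, [:: [:: 1; 1]; [::]; [::]; [:: 1]]%N);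
        ((zm 1 * comm (yp 1) (yp 2))%nc, [:: [:: 1; 1]; [::]; [::]; [:: 1]]%N)] /\
  (* (7) *)
  decomp F [:: 1; 1; 1; 0]%N
    [:: ((comm (yp 1) (ym 1) * zp 1)%nc, [:: [:: 1]; [:: 1]; [:: 1]; [::]]%N);
        ((zp 1 * comm (yp 1) (ym 1))%nc, [:: [:: 1]; [:: 1]; [:: 1]; [::]]%N)] /\
  (* (8) *)
  decomp F [:: 1; 1; 0; 1]%N
    [:: ((comm (yp 1) (ym 1) * zm 1)%nc, [:: [:: 1]; [:: 1]; [::]; [:: 1]]%N);
        ((zm 1 * comm (yp 1) (ym 1))%nc, [:: [:: 1]; [:: 1]; [::]; [:: 1]]%N)] /\
  (* (9) *)
  decomp F [:: 1; 0; 2; 0]%N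
    [:: (comm (yp 1) (zp 1 * zp 1), [:: [:: 1]; [::]; [:: 2]; [::]]%N);
        (comm (yp 1) (zp 1 * zp 2 - zp 2 * zp 1),
           [:: [:: 1]; [::]; [:: 1; 1]; [::]]%N)] /\
  (* (10) *)
  decomp F [:: 1; 0; 0; 2]%N
    [:: (comm (yp 1) (zm 1 * zm 1), [:: [:: 1]; [::]; [::]; [:: 2]]%N);
        (comm (yp 1) (zm 1 * zm 2 - zm 2 * zm 1),
           [:: [:: 1]; [::]; [::]; [:: 1; 1]]%N)] /\
  (* (11) *)
  decomp F [:: 1; 0; 1; 1]%N
    [:: (comm (yp 1) (zp 1 * zm 1), [:: [:: 1]; [::]; [:: 1]; [:: 1]]%N);
        (comm (yp 1) (zm 1 * zp 1), [:: [:: 1]; [::]; [:: 1]; [:: 1]]%N)] /\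
  (* (12) *)
  decomp F [:: 0; 0; 3; 0]%N
    [:: ((zp 1 * zp 1 * zp 1)%nc, [:: [::]; [::]; [:: 3]; [::]]%N);
        (St3 (zp 1) (zp 2) (zp 3), [:: [::]; [::]; [:: 1; 1; 1]; [::]]%N)] /\
  (* (13) *)
  decomp F [:: 0; 0; 0; 3]%N
    [:: ((zm 1 * zm 1 * zm 1)%nc, [:: [::]; [::]; [::]; [:: 3]]%N);
        (St3 (zm 1) (zm 2) (zm 3), [:: [::]; [::]; [::]; [:: 1; 1; 1]]%N)] /\
  (* (14) *)
  decomp F [:: 0; 2; 1; 0]%N
    [:: ((ym 1 * zp 1 * ym 1)%nc, [:: [::]; [:: 2]; [:: 1]; [::]]%N);
        ((ym 1 * zp 1 * ym 2 - ym 2 * zp 1 * ym 1)%nc,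
           [:: [::]; [:: 1; 1]; [:: 1]; [::]]%N)] /\
  (* (15) *)
  decomp F [:: 0; 2; 0; 1]%N
    [:: ((ym 1 * zm 1 * ym 1)%nc, [:: [::]; [:: 2]; [::]; [:: 1]]%N);
        ((ym 1 * zm 1 * ym 2 - ym 2 * zm 1 * ym 1)%nc,
           [:: [::]; [:: 1; 1]; [::]; [:: 1]]%N)] /\
  (* (16) *)
  decomp F [:: 0; 1; 2; 0]%N
    [:: ((zp 1 * ym 1 * zp 2 - zp 2 * ym 1 * zp 1)%nc,
           [:: [::]; [:: 1]; [:: 1; 1]; [::]]%N);
        (comm (ym 1) (zp 1 * zp 2 - zp 2 * zp 1),
           [:: [::]; [:: 1]; [:: 1; 1]; [::]]%N)] /\
  (* (17) *)
  decomp F [:: 0; 1; 0; 2]%N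
    [:: ((zm 1 * ym 1 * zm 2 - zm 2 * ym 1 * zm 1)%nc,
           [:: [::]; [:: 1]; [::]; [:: 1; 1]]%N);
        (comm (ym 1) (zm 1 * zm 2 - zm 2 * zm 1),
           [:: [::]; [:: 1]; [::]; [:: 1; 1]]%N)] /\
  (* (18) *)
  decomp F [:: 0; 0; 2; 1]%N
    [:: ((zp 1 * zp 1 * zm 1 - zp 1 * zm 1 * zp 1 + zm 1 * (zp 1 * zp 1))%nc,
           [:: [::]; [::]; [:: 2]; [:: 1]]%N);
        ((comm (zp 1) (zp 2) * zm 1 + (zp 1 * zm 1 * zp 2 - zp 2 * zm 1 * zp 1)
            + zm 1 * comm (zp 1) (zp 2))%nc,
           [:: [::]; [::]; [:: 1; 1]; [:: 1]]%N)] /\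
  (* (19) *)
  decomp F [:: 0; 0; 1; 2]%N
    [:: ((zm 1 * zm 1 * zp 1 - zm 1 * zp 1 * zm 1 + zp 1 * (zm 1 * zm 1))%nc,
           [:: [::]; [::]; [:: 1]; [:: 2]]%N);
        ((comm (zm 1) (zm 2) * zp 1 + (zm 1 * zp 1 * zm 2 - zm 2 * zp 1 * zm 1)
            + zp 1 * comm (zm 1) (zm 2))%nc,
           [:: [::]; [::]; [:: 1]; [:: 1; 1]]%N)] /\
  (* (20) *)
  decomp F [:: 0; 1; 1; 1]%N
    [:: ((zp 1 * ym 1 * zm 1 + zm 1 * ym 1 * zp 1)%nc,
           [:: [::]; [:: 1]; [:: 1]; [:: 1]]%N);
        (comm (ym 1) (zp 1 * zm 1 + zm 1 * zp 1),
           [:: [::]; [:: 1]; [:: 1]; [:: 1]]%N)].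
Proof.
(* In every case the vectors and the equations number six together. Here even symmetric matrices
   commute, so the single equation says that the six coefficients sum to 0; its kernel has dimension
   5 = 2 + 2 + 1, two hooks and a sign vector. *)
split; first by apply: (decomp_check char0
    (cert := [:: hook [:: 0; 4; -4; 4; -4; 0] [:: 4; 0; -4; 0; -4; 4];
              hook [:: 4; 0; 4; -4; 0; -4] [:: 0; 4; 0; -4; 4; -4];
              line [:: 2; -2; -2; 2; 2; -2]])
    (eqs := [:: Equation [:: 0; 0; 0]%N (0, 0)%N [:: 2; 2; 2; 2; 2; 2]])); certify.
split; first by apply: (decomp_check char0
    (cert := [:: hook [:: 4; 2; 2; -2; -2; -4] [:: 2; 4; -2; -4; 2; -2]])
    (eqs := [:: Equation [:: 0; 0; 0]%N (1, 1)%N [:: 1; 5; 2; 1; -2; 5];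
             Equation [:: 0; 0; 1]%N (1, 2)%N [:: 2; -5; 1; -1; 5; -2];
             Equation [:: 0; 1; 0]%N (1, 2)%N [:: -1; -2; 1; 2; 5; -5];
             Equation [:: 0; 1; 2]%N (1, 1)%N [:: 4; -4; -4; 4; 4; -4]])); certify.
(* Even symmetric matrices are scalar on the 2 by 2 block, where the skew even part lives, so again
   only the sum of the coefficients matters. *)
split; first by apply: (decomp_check char0
    (cert := [:: line [:: 4; -2; 4; -2; -2; -2];
              line [:: -2; 4; -2; 4; -2; -2];
              line [:: 6; 0; -6; 0; 0; 0];
              line [:: 0; 6; 0; -6; 0; 0];
              line [:: 0; 0; 0; 0; 6; -6]])
    (eqs := [:: Equation [:: 1; 1; 0]%N (1, 1)%N [:: 2; 2; 2; 2; 2; 2]])); certify.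
split; first by apply: (decomp_check char0
    (cert := [:: line [:: 4; 4; -2; -2; -2; -2];
              line [:: -2; -2; 4; -2; 4; -2];
              line [:: 4; -4; -2; -2; 2; 2];
              line [:: -2; 2; 4; -2; -4; 2]])
    (eqs := [:: Equation [:: 1; 0; 0]%N (1, 1)%N [:: 2; 2; 2; 2; 2; 2];
             Equation [:: 1; 0; 1]%N (1, 2)%N [:: 2; -2; 2; 2; -2; -2]])); certify.
split; first by apply: (decomp_check char0
    (cert := [:: line [:: 6; 0; -6; 0; 0; 0];
              line [:: 0; 0; 0; 0; 6; -6]])
    (eqs := [:: Equation [:: 0; 0; 0]%N (0, 1)%N [:: 6; 0; 6; 0; 0; 0];
             Equation [:: 0; 0; 0]%N (2, 0)%N [:: 0; 0; 0; 0; -6; -6];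
             Equation [:: 0; 1; 0]%N (0, 1)%N [:: 0; 12; 0; 0; 0; 0];
             Equation [:: 0; 1; 0]%N (2, 0)%N [:: 0; 0; 0; -12; 0; 0]])); certify.
split; first by apply: (decomp_check char0
    (cert := [:: line [:: 6; 0; -6; 0; 0; 0];
              line [:: 0; 0; 0; 0; 6; -6]])
    (eqs := [:: Equation [:: 0; 0; 0]%N (0, 1)%N [:: 6; 0; 6; 0; 0; 0];
             Equation [:: 0; 0; 0]%N (2, 0)%N [:: 0; 0; 0; 0; 6; 6];
             Equation [:: 0; 1; 0]%N (0, 1)%N [:: 0; 12; 0; 0; 0; 0];
             Equation [:: 0; 1; 0]%N (2, 0)%N [:: 0; 0; 0; 12; 0; 0]])); certify.
split; first by apply: (decomp_check char0
    (cert := [:: line [:: 6; 0; -6; 0; 0; 0];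
              line [:: 0; 0; 0; 0; 6; -6]])
    (eqs := [:: Equation [:: 0; 0; 0]%N (0, 1)%N [:: 0; 12; 0; 0; 0; 0];
             Equation [:: 0; 0; 0]%N (2, 0)%N [:: 0; 0; 0; 12; 0; 0];
             Equation [:: 1; 0; 0]%N (0, 1)%N [:: 0; 0; 0; 0; 6; 6];
             Equation [:: 1; 0; 0]%N (2, 0)%N [:: 6; 0; 6; 0; 0; 0]])); certify.
split; first by apply: (decomp_check char0
    (cert := [:: line [:: 6; 0; -6; 0; 0; 0];
              line [:: 0; 0; 0; 0; 6; -6]])
    (eqs := [:: Equation [:: 0; 0; 0]%N (0, 1)%N [:: 0; 12; 0; 0; 0; 0];
             Equation [:: 0; 0; 0]%N (2, 0)%N [:: 0; 0; 0; -12; 0; 0];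
             Equation [:: 1; 0; 0]%N (0, 1)%N [:: 0; 0; 0; 0; 6; 6];
             Equation [:: 1; 0; 0]%N (2, 0)%N [:: -6; 0; -6; 0; 0; 0]])); certify.
split; first by apply: (decomp_check char0
    (cert := [:: line [:: 3; 3; 0; -3; 0; -3];
              line [:: 3; -3; 0; -3; 0; 3]])
    (eqs := [:: Equation [:: 0; 0; 0]%N (2, 1)%N [:: 0; 0; -12; 0; 0; 0];
             Equation [:: 0; 0; 1]%N (0, 0)%N [:: 3; -3; 0; 3; 0; -3];
             Equation [:: 0; 0; 1]%N (1, 1)%N [:: 0; 0; -12; 0; 12; 0];
             Equation [:: 1; 0; 0]%N (2, 1)%N [:: -3; -3; 0; -3; 0; -3]])); certify.
split; first by apply: (decomp_check char0
    (cert := [:: line [:: 3; 3; 0; -3; 0; -3];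
              line [:: 3; -3; 0; -3; 0; 3]])
    (eqs := [:: Equation [:: 0; 0; 0]%N (2, 1)%N [:: 0; 0; 12; 0; 0; 0];
             Equation [:: 0; 0; 1]%N (0, 0)%N [:: -3; 3; 0; -3; 0; 3];
             Equation [:: 0; 0; 1]%N (1, 1)%N [:: 0; 0; 12; 0; -12; 0];
             Equation [:: 1; 0; 0]%N (2, 1)%N [:: 3; 3; 0; 3; 0; 3]])); certify.
split; first by apply: (decomp_check char0
    (cert := [:: line [:: 6; 0; 0; -6; 0; 0];
              line [:: 0; 6; 0; 0; 0; -6]])
    (eqs := [:: Equation [:: 0; 0; 0]%N (2, 1)%N [:: 0; 0; -12; 0; 0; 0];
             Equation [:: 0; 0; 1]%N (0, 0)%N [:: -3; -3; 0; -3; 0; -3];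
             Equation [:: 0; 0; 1]%N (1, 1)%N [:: 0; 0; -12; 0; -12; 0];
             Equation [:: 1; 0; 0]%N (2, 1)%N [:: -3; 3; 0; -3; 0; 3]])); certify.
split; first by apply: (decomp_check char0
    (cert := [:: line [:: 2; 2; 2; 2; 2; 2];
              line [:: 2; -2; -2; 2; 2; -2]])
    (eqs := [:: Equation [:: 0; 0; 1]%N (0, 1)%N [:: 4; 4; 0; 0; -4; -4];
             Equation [:: 0; 0; 1]%N (2, 0)%N [:: -4; 0; -4; 4; 0; 4];
             Equation [:: 0; 1; 0]%N (0, 1)%N [:: 4; 4; -4; -4; 0; 0];
             Equation [:: 0; 1; 0]%N (2, 0)%N [:: 0; -4; 0; 4; -4; 4]])); certify.
split; first by apply: (decomp_check char0
    (cert := [:: line [:: 2; 2; 2; 2; 2; 2];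
              line [:: 2; -2; -2; 2; 2; -2]])
    (eqs := [:: Equation [:: 0; 0; 1]%N (0, 1)%N [:: -4; -4; 0; 0; 4; 4];
             Equation [:: 0; 0; 1]%N (2, 0)%N [:: -4; 0; -4; 4; 0; 4];
             Equation [:: 0; 1; 0]%N (0, 1)%N [:: -4; -4; 4; 4; 0; 0];
             Equation [:: 0; 1; 0]%N (2, 0)%N [:: 0; -4; 0; 4; -4; 4]])); certify.
split; first by apply: (decomp_check char0
    (cert := [:: line [:: 0; 6; 0; 6; 0; 0];
              line [:: 0; 6; 0; -6; 0; 0]])
    (eqs := [:: Equation [:: 0; 0; 0]%N (0, 1)%N [:: 0; 0; 0; 0; 6; 6];
             Equation [:: 0; 0; 0]%N (2, 0)%N [:: -6; 0; -6; 0; 0; 0];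
             Equation [:: 0; 1; 0]%N (0, 2)%N [:: 0; 0; 0; 0; 6; -6];
             Equation [:: 0; 1; 0]%N (1, 0)%N [:: -6; 0; 6; 0; 0; 0]])); certify.
split; first by apply: (decomp_check char0
    (cert := [:: line [:: 0; 6; 0; 6; 0; 0];
              line [:: 0; 6; 0; -6; 0; 0]])
    (eqs := [:: Equation [:: 0; 0; 0]%N (0, 1)%N [:: 0; 0; 0; 0; 6; 6];
             Equation [:: 0; 0; 0]%N (2, 0)%N [:: 6; 0; 6; 0; 0; 0];
             Equation [:: 0; 1; 0]%N (0, 2)%N [:: 0; 0; 0; 0; 6; -6];
             Equation [:: 0; 1; 0]%N (1, 0)%N [:: 6; 0; -6; 0; 0; 0]])); certify.
split; first by apply: (decomp_check char0
    (cert := [:: line [:: 0; 0; 6; 0; -6; 0];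
              line [:: 3; -3; 0; -3; 0; 3]])
    (eqs := [:: Equation [:: 0; 0; 0]%N (2, 1)%N [:: 3; 3; 0; -3; 0; -3];
             Equation [:: 0; 0; 1]%N (0, 0)%N [:: 0; 0; 6; 0; 6; 0];
             Equation [:: 0; 0; 1]%N (1, 1)%N [:: 0; 6; 0; 0; 0; 6];
             Equation [:: 0; 0; 1]%N (2, 2)%N [:: 6; 0; 0; 6; 0; 0]])); certify.
split; first by apply: (decomp_check char0
    (cert := [:: line [:: 0; 0; 6; 0; -6; 0];
              line [:: 3; -3; 0; -3; 0; 3]])
    (eqs := [:: Equation [:: 0; 0; 0]%N (2, 1)%N [:: -3; -3; 0; 3; 0; 3];
             Equation [:: 0; 0; 1]%N (0, 0)%N [:: 0; 0; -6; 0; -6; 0];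
             Equation [:: 0; 0; 1]%N (1, 1)%N [:: 0; -6; 0; 0; 0; -6];
             Equation [:: 0; 0; 1]%N (2, 2)%N [:: -6; 0; 0; -6; 0; 0]])); certify.
split; first by apply: (decomp_check char0
    (cert := [:: line [:: 2; -2; 2; -2; 2; 2];
              line [:: 2; 2; -2; -2; 2; -2]])
    (eqs := [:: Equation [:: 0; 0; 1]%N (0, 1)%N [:: 4; -4; 0; 0; -4; -4];
             Equation [:: 0; 0; 1]%N (2, 0)%N [:: 4; 0; 4; 4; 0; -4];
             Equation [:: 0; 1; 0]%N (0, 1)%N [:: 4; -4; -4; 4; 0; 0];
             Equation [:: 0; 1; 0]%N (2, 0)%N [:: 0; -4; 0; 4; 4; -4]])); certify.
split; first by apply: (decomp_check char0
    (cert := [:: line [:: 2; 2; -2; 2; -2; 2];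
              line [:: 2; -2; 2; 2; -2; -2]])
    (eqs := [:: Equation [:: 0; 0; 1]%N (0, 1)%N [:: -4; -4; 0; 0; -4; 4];
             Equation [:: 0; 0; 1]%N (2, 0)%N [:: 4; 0; -4; -4; 0; -4];
             Equation [:: 0; 1; 0]%N (0, 1)%N [:: -4; -4; -4; 4; 0; 0];
             Equation [:: 0; 1; 0]%N (2, 0)%N [:: 0; 4; 0; -4; -4; -4]])); certify.
by apply: (decomp_check char0
    (cert := [:: line [:: 0; 0; 6; 0; 6; 0];
              line [:: 3; 3; 0; -3; 0; -3]])
    (eqs := [:: Equation [:: 0; 0; 0]%N (2, 1)%N [:: 3; -3; 0; -3; 0; 3];
             Equation [:: 0; 0; 1]%N (0, 0)%N [:: 0; 0; -6; 0; 6; 0];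
             Equation [:: 0; 0; 1]%N (1, 1)%N [:: 0; -6; 0; 0; 0; -6];
             Equation [:: 0; 0; 1]%N (2, 2)%N [:: 6; 0; 0; 6; 0; 0]])); certify.
Qed.
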